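(* Fix integers $r,s$ with $0\le s<r$. There is a constant $C=C(r,s)$ such that for all $n$ and all integers $t\ge 2$, $$\operatorname{hom}(C_t,G(n,r,s))=N_1^t\left(1+\delta_0+\sum_{j=1}^{s}\frac{n^j}{j!}\left(\frac{\binom{r-j}{s-j}}{\binom{r}{s}}+\delta_j\right)^t\right)$$ for some real numbers $\delta_0,\dots,\delta_s$ (depending on $n,t$) with $|\delta_j|\le C/n$ for all $j$. Moreover, suppose $s\ge 1$ and fix $\varepsilon>0$. For $j\in\{0,1,\dots,s-1\}$ put $a_j=\ln\binom{r-j}{s-j}-\ln\binom{r-j-1}{s-j-1}=\ln\frac{r-j}{s-j}$ (so $a_0<a_1<\dots<a_{s-1}$, $a_0=\ln(r/s)$, $a_{s-1}=\ln(r-s+1)$). Define the sets of positive integers $$I_0=\{t:\ t>(1+\varepsilon)\ln n/a_0\},\qquad I_s=\{t:\ 2\le t<(1-\varepsilon)\ln n/a_{s-1}\},$$ $$I_j=\{t:\ (1+\varepsilon)\ln n/a_j<t<(1-\varepsilon)\ln n/a_{j-1}\},\quad j\in\{1,\dots,s-1\}.$$ Then for every $j\in\{0,\dots,s\}$ and every sequence $t=t(n)\in I_j$, $$\operatorname{hom}(C_t,G(n,r,s))\sim N_1^t\,\frac{n^j}{j!}\left(\frac{\binom{r-j}{s-j}}{\binom{r}{s}}\right)^t\qquad(n\to\infty).$$ In particular $\operatorname{hom}(C_t)\sim N_1^t$ for $t\in I_0$ and $\operatorname{hom}(C_t)\sim N_1^t\frac{n^s}{s!}\binom{r}{s}^{-t}$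 for $t\in I_s$.
   Context: For integers $0\le s<r<n$, the generalized Johnson graph $G(n,r,s)$ is the simple graph whose vertices are the $r$-element subsets of $\{1,\dots,n\}$, two vertices $x,y$ being adjacent iff $|x\cap y|=s$. Here $r,s$ are constants and $n\to\infty$. Let $N=\binom{n}{r}$ and $N_1=\binom{r}{s}\binom{n-r}{r-s}$ (the vertex degree). $C_t$ denotes the cycle on $t$ vertices, and $\operatorname{hom}(H,G)$ is the number of graph homomorphisms (edge-preserving maps $V(H)\to V(G)$) from $H$ to $G$. *)

(* Defs.v *)
From HB Require Import structures.
From mathcomp Require Import all_boot all_order all_algebra.
From mathcomp Require Import all_classical all_reals all_analysis.
Set Implicit Arguments. Unset Strict Implicit. Unset Printing Implicit Defensive.
Import Order.TTheory GRing.Theory Num.Theory.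

Definition jvert (n r : nat) : finType := {x : {set 'I_n} | #|x| == r}.

Definition jadj (n r s : nat) : rel (jvert n r) :=
  fun x y => #|val x :&: val y| == s.

Definition cycle_rel (t : nat) : rel 'I_t :=
  fun i j => (i != j) && ((val j == i.+1 %% t) || (val i == j.+1 %% t)).

Definition hom (V W : finType) (H : rel V) (G : rel W) : nat :=
  #|[set f : {ffun V -> W} | [forall i, forall j, H i j ==> G (f i) (f j)]]|.

Definition homC (t n r s : nat) : nat := hom (@cycle_rel t) (@jadj n r s).

(* The degree N_1 = C(r,s) C(n-r, r-s). *)
Definition N1 (n r s : nat) : nat := 'C(r, s) * 'C(n - r, r - s).

Local Open Scope ring_scope.

Definition a_ (R : realType) (r s j : nat) : R :=
  ln ((r - j)%:R / (s - j)%:R).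

Definition inI (R : realType) (r s : nat) (eps : R) (j n t : nat) : Prop :=
  if j == 0%N then (1 + eps) * ln n%:R / a_ R r s 0 < t%:R
  else if j == s then (2 <= t)%N && (t%:R < (1 - eps) * ln n%:R / a_ R r s (s.-1))
  else ((1 + eps) * ln n%:R / a_ R r s j < t%:R) &&
       (t%:R < (1 - eps) * ln n%:R / a_ R r s (j.-1)).

(* Main.v *)
Require Import Defs.
From HB Require Import structures.
From mathcomp Require Import all_boot all_order all_algebra.
From mathcomp Require Import all_classical all_reals all_analysis.
From mathcomp Require Import zify ring lra.
From mathcomp Require Import finset.
Set Implicit Arguments. Unset Strict Implicit. Unset Printing Implicit Defensive.
Import Order.TTheory GRing.Theory Num.Theory.
Local Open Scope ring_scope.

(** hom(C_t, G) is the trace of A^t, where A is the adjacency matrix of G(n,r,s).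
    Let W_i be the inclusion matrix of i-subsets versus r-subsets.  The (u, y)
    entry of W_i A counts the r-sets x containing u with |x ∩ y| = s, which depends
    on k = |u ∩ y| only; expanding it in the binomials C(k, m) gives
    W_i A = λ_i W_i + (combination of rows of W_0, …, W_(i-1)), where λ_i is an
    i-th finite difference.  So A is scalar on the successive quotients of
    the flag of row spaces, and tr A^t = Σ_i (rk W_i - rk W_(i-1)) λ_i^t.

    No exact rank is needed: the i-sets avoiding a fixed (r-i)-set give an identity
    submatrix of W_i, hence C(n-r+i, i) <= rk W_i <= C(n, i), so the multiplicities are
    n^i/i! (1 + O(1/n)).  For the eigenvalues, λ_i / N_1 is C(r-i,s-i)/C(r,s) + O(1/n)
    when i <= s and O(n^(s-i)) when i > s; as t >= 2, the terms with i > s are O(1/n)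
    relative to the term i = s.  A factor 1 + O(1/n) is moved inside the t-th power
    by taking its t-th root, which is at least as close to 1.

    For the asymptotics, consecutive terms of the expansion differ by the factor
    exp(ln n - t a_k), up to exp(O(t/n)), and a_k increases with k. *)

(** * Closed walks and homomorphisms from cycles *)

Section ClosedWalks.
Variables (F : comNzRingType) (T : finType) (e : rel T).

Definition adjmx : 'M[F]_#|T| :=
  \matrix_(i, j) (e (enum_val i) (enum_val j))%:R.

Lemma adjmx_expE m x y :
  (adjmx ^+ m.+1) (enum_rank x) (enum_rank y) =
  \sum_(p : m.-tuple T) (path e x (rcons p y))%:R.
Proof.
elim: m x => [|m IH] x.
  rewrite expr1 mxE !enum_rankK (big_pred1 [tuple]) /= ?andbT // => p.
  by apply/esym/eqP; exact: tuple0.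
rewrite exprS -mulmxE mxE.
rewrite (reindex _ (onW_bij _ (@enum_rank_bij T))) /=.
rewrite (eq_bigr (fun z => (e x z)%:R * \sum_(p : m.-tuple T) (path e z (rcons p y))%:R)); last first.
  by move=> z _; rewrite mxE !enum_rankK IH.
under eq_bigr do rewrite big_distrr /=.
rewrite pair_bigA /=.
rewrite (reindex (fun p : T * m.-tuple T => [tuple of p.1 :: p.2])) /=.
  by apply: eq_bigr => -[z p] _ /=; rewrite -natrM mulnb.
exists (fun p : m.+1.-tuple T => (thead p, [tuple of behead p])) => /= p _.
  by rewrite theadE; case: p => a b; congr pair; apply: val_inj.
by rewrite -tuple_eta.
Qed.

Lemma mxtrace_adjmx_exp m :
  \tr (adjmx ^+ m.+1) = (#|[set p : m.+1.-tuple T | cycle e p]|)%:R.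
Proof.
rewrite /mxtrace.
rewrite (reindex _ (onW_bij _ (@enum_rank_bij T))) /=.
under eq_bigr do rewrite adjmx_expE.
rewrite pair_bigA /=.
rewrite -sum1_card natr_sum [RHS]big_mkcond /=.
rewrite [RHS](reindex (fun p : T * m.-tuple T => [tuple of p.1 :: p.2])) /=.
  by apply: eq_bigr => -[z p] _ /=; rewrite inE /=; case: path.
exists (fun p : m.+1.-tuple T => (thead p, [tuple of behead p])) => /= p _.
  by rewrite theadE; case: p => a b; congr pair; apply: val_inj.
by rewrite -tuple_eta.
Qed.

Lemma cycle_nthP m (x0 : T) (p : m.-tuple T) :
  reflect (forall i, (i < m)%N -> e (nth x0 p i) (nth x0 p (i.+1 %% m)))
          (cycle e p).
Proof.
case: m p => [|m] p.
  by rewrite tuple0 /=; apply: (iffP idP).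
case/tupleP: p => x p /=.
apply: (iffP (pathP x0)); rewrite size_rcons size_tuple.
  move=> H i im; have := H i im.
  rewrite -rcons_cons !nth_rcons /= size_tuple im.
  move: im; rewrite ltnS leq_eqVlt => /orP[/eqP -> |im].
    by rewrite ltnn eqxx modnn.
  by rewrite im modn_small ?ltnS.
move=> H i im; have := H i im.
rewrite -rcons_cons !nth_rcons /= size_tuple im.
move: im; rewrite ltnS leq_eqVlt => /orP[/eqP -> |im].
  by rewrite ltnn eqxx modnn.
by rewrite im modn_small ?ltnS.
Qed.

(** For m = 1 the two sides differ: [cycle_rel] has no loop, while [cycle] on one vertex asks for
    one. Symmetry is used because [cycle_rel] contains both orientations of each edge. *)
Lemma cycle_rel_homP m (f : 'I_m -> T) : (1 < m)%N -> symmetric e ->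
  reflect (forall i j, cycle_rel i j -> e (f i) (f j))
          (cycle e [tuple f i | i < m]).
Proof.
case: m f => [//|m] f m1 es.
apply: (iffP (cycle_nthP (f ord0) _)) => [H i j|H i im].
- have K (k : 'I_m.+1) : nth (f ord0) [tuple f i | i < m.+1] k = f k.
    by rewrite -tnth_nth tnth_mktuple.
  rewrite /cycle_rel => /andP[_ /orP[/eqP ji|/eqP ij]].
    by have := H i (ltn_ord i); rewrite -ji !K.
  by have := H j (ltn_ord j); rewrite -ij !K es.
have K (k : 'I_m.+1) : nth (f ord0) [tuple f i | i < m.+1] k = f k.
  by rewrite -tnth_nth tnth_mktuple.
pose i' := Ordinal im; pose j' := Ordinal (ltn_pmod i.+1 (ltn0Sn m)).
rewrite (K i') (K j'); apply: H.
rewrite /cycle_rel eqxx andbT /= -val_eqE /=.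
have := im; rewrite {1}ltnS leq_eqVlt => /orP[/eqP -> |im'].
  by rewrite modnn -lt0n.
by rewrite modn_small ?ltnS // neq_ltn ltnSn.
Qed.

Lemma hom_cycle_trace m : (1 < m)%N -> symmetric e ->
  (Defs.hom (@cycle_rel m) e)%:R = \tr (adjmx ^+ m).
Proof.
case: m => [//|m] m1 es; rewrite mxtrace_adjmx_exp /Defs.hom; congr (_%:R).
rewrite -!sum1_card big_mkcond [RHS]big_mkcond /=.
rewrite (reindex (fun p : m.+1.-tuple T => [ffun i => tnth p i])) /=.
  apply: eq_bigr => p _; rewrite !inE.
  congr (if _ then _ else _).
  have -> : cycle e p = cycle e [tuple tnth p i | i < m.+1].
    by rewrite (_ : [tuple tnth p i | i < m.+1] = p) //; apply: eq_from_tnth => i; rewrite tnth_mktuple.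
  apply/forallP/(cycle_rel_homP _ m1 es) => H i.
    by move=> j ij; have := forallP (H i) j; rewrite !ffunE ij.
  by apply/forallP => j; apply/implyP => ij; rewrite !ffunE; apply: H.
exists (fun f : {ffun 'I_m.+1 -> T} => [tuple f i | i < m.+1]) => /= p _.
  by apply: eq_from_tnth => i; rewrite tnth_mktuple ffunE.
by apply/ffunP => i; rewrite ffunE tnth_mktuple.
Qed.

End ClosedWalks.

(** * Trace along an invariant flag *)

Section FlagTrace.
Variables (F : fieldType) (N : nat).

(** In a rank factorisation P = C R, cancelling C on the left and R on the right of CRCR = CR gives
    RC = 1, and tr(CR) = tr(RC). *)
Lemma mxtrace_idem (P : 'M[F]_N) : P *m P = P -> \tr P = (\rank P)%:R.
Proof.
move=> PP.
have RC : row_base P *m col_base P = 1%:M.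
  apply: (row_full_inj (col_base_full P)); apply: (row_free_inj (row_base_free P)).
  by rewrite mulmx1 mulmxA -(mulmxA (_ *m _)) mulmx_base PP.
by rewrite -{1}(mulmx_base P) mxtrace_mulC RC mxtrace1.
Qed.

(** Some projection onto the row space of [V], acting on row vectors from the right; orthogonality
    is not claimed. *)
Definition projmx (V : 'M[F]_N) : 'M[F]_N := pinvmx V *m V.

Lemma projmx_id m (X : 'M[F]_(m, N)) V : (X <= V)%MS -> X *m projmx V = X.
Proof. by move=> XV; rewrite mulmxA mulmxKpV. Qed.

Lemma projmx_sub V : (projmx V <= V)%MS.
Proof. exact: submxMl. Qed.

Lemma mxtrace_projmx V : \tr (projmx V) = (\rank V)%:R.
Proof.
rewrite mxtrace_idem ?projmx_id ?projmx_sub //; congr (_%:R); apply/eqP.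
rewrite eqn_leq mxrankS ?projmx_sub //=.
by rewrite -{1}(projmx_id (submx_refl V)) mxrankM_maxr.
Qed.

(* A - l_i maps the i-th space into the previous one, so the trace of its
   composition with the projection is unchanged when one projects further down. *)
Lemma mxtrace_flag k (V : nat -> 'M[F]_N) (A : 'M[F]_N) (l : nat -> F) :
  V 0 = 0 -> row_full (V k) ->
  (forall i, (i < k)%N -> (V i <= V i.+1)%MS) ->
  (forall i, (i < k)%N -> (V i.+1 *m (A - (l i)%:M) <= V i)%MS) ->
  \tr A = \sum_(i < k) ((\rank (V i.+1))%:R - (\rank (V i))%:R) * l i.
Proof.
move=> V0 Vk Vmon VA.
have step i : (i < k)%N -> \tr (projmx (V i.+1) *m A) - \tr (projmx (V i) *m A) =
    ((\rank (V i.+1))%:R - (\rank (V i))%:R) * l i.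
  move=> ik.
  have E : \tr (projmx (V i.+1) *m (A - (l i)%:M)) =
           \tr (projmx (V i) *m (A - (l i)%:M)).
    have sub : (projmx (V i.+1) *m (A - (l i)%:M) <= V i)%MS.
      by rewrite /projmx -mulmxA mulmx_sub ?VA.
    rewrite -[X in \tr X](projmx_id sub) mxtrace_mulC mulmxA projmx_id //.
    exact: submx_trans (projmx_sub _) (Vmon i ik).
  move: E; rewrite !mulmxBr !linearB /= !mul_mx_scalar !mxtraceZ !mxtrace_projmx.
  by move/(canRL (subrK _)) => ->; rewrite addrC -addrA addKr addrC mulrBl !(mulrC _ (l i)).
have tele : \sum_(i < k) (\tr (projmx (V i.+1) *m A) - \tr (projmx (V i) *m A)) =
    \tr A.
  rewrite -(big_mkord xpredT (fun i => \tr (projmx (V i.+1) *m A) - \tr (projmx (V i) *m A))).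
  rewrite telescope_sumr // V0 /projmx mulmx0 mul0mx mxtrace0 subr0.
  by rewrite mulVpmx // mul1mx.
by rewrite -tele; apply: eq_bigr => i _; apply: step.
Qed.

(** The same flag serves A^t with scalars l_i^t: A stabilises each space, and A^(t+1) - l^(t+1) = A
    (A^t - l^t) + l^t (A - l). *)
Lemma mxtrace_exp_flag k (V : nat -> 'M[F]_N) (A : 'M[F]_N) (l : nat -> F) t :
  V 0 = 0 -> row_full (V k) ->
  (forall i, (i < k)%N -> (V i <= V i.+1)%MS) ->
  (forall i, (i < k)%N -> (V i.+1 *m (A - (l i)%:M) <= V i)%MS) ->
  \tr (A ^+ t) = \sum_(i < k) ((\rank (V i.+1))%:R - (\rank (V i))%:R) * l i ^+ t.
Proof.
move=> V0 Vk Vmon VA.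
have stab i : (i < k)%N -> (V i.+1 *m A <= V i.+1)%MS.
  move=> ik; rewrite -[A](subrK ((l i)%:M)) mulmxDr mul_mx_scalar.
  by rewrite addmx_sub ?scalemx_sub // (submx_trans (VA i ik)) ?Vmon.
apply: (mxtrace_flag (l := fun i => l i ^+ t) V0) => // i ik.
elim: t => [|t IH]; first by rewrite !expr0 subrr mulmx0 sub0mx.
have -> : A ^+ t.+1 - (l i ^+ t.+1)%:M =
    A *m (A ^+ t - (l i ^+ t)%:M) + l i ^+ t *: (A - (l i)%:M).
  rewrite exprS -mulmxE mulmxBr mul_mx_scalar scalerBr scale_scalar_mx -exprSr.
  by rewrite addrA subrK.
rewrite mulmxDr mulmxA -scalemxAr addmx_sub ?scalemx_sub ?VA //.
exact: submx_trans (submxMr _ (stab i ik)) IH.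
Qed.

End FlagTrace.

(** * Subset counts and finite differences *)

Section SubsetCounting.
Variable T : finType.
Implicit Types a b p u x y : {set T}.

Lemma card_between a b m : a \subset b ->
  #|[set p : {set T} | [&& a \subset p, p \subset b & #|p| == m]]| =
  if (#|a| <= m)%N then 'C(#|b| - #|a|, m - #|a|) else 0%N.
Proof.
move=> ab; case: leqP => am; last first.
  apply/eqP; rewrite cards_eq0; apply/eqP/setP => p; rewrite !inE.
  apply/negP => /and3P[/subset_leq_card ap _ /eqP pm].
  by move: am; rewrite -pm ltnNge ap.
rewrite -cardsDS // -cards_draws.
set D := [set A : {set T} | (A \subset b :\: a) && (#|A| == m - #|a|)%N].
rewrite -(card_in_imset (f := fun p => a :|: p) (D := mem D)); last first.
  move=> p q; rewrite !inE !subsetD => /andP[/andP[_ pa] _] /andP[/andP[_ qa] _].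
  move=> /(congr1 (fun z => z :\: a)).
  rewrite !setDUl setDv !set0U => E; move: E.
  by move/setDidPl: pa => ->; move/setDidPl: qa => ->.
apply: eq_card => p; rewrite !inE; apply/and3P/imsetP.
  move=> [ap pb /eqP pm]; exists (p :\: a).
    by rewrite inE setSD //= cardsDS // pm.
  by rewrite setDE setUIr setUCr setIT (setUidPr ap).
move=> [q]; rewrite inE subsetD => /andP[/andP[qb qa] /eqP qm ->].
split; first exact: subsetUl.
  by rewrite subUset ab.
by rewrite cardsU disjoint_setI0 1?disjoint_sym // cards0 subn0 qm subnKC.
Qed.

(** The parts of x inside and outside y are chosen independently. *)
Lemma card_meet_split u y r s : (s <= r)%N ->
  #|[set x : {set T} | [&& #|x| == r, u \subset x & #|x :&: y| == s]]| =
  (#|[set p : {set T} | [&& u :&: y \subset p, p \subset y & #|p| == s]]| *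
   #|[set q : {set T} | [&& u :\: y \subset q, q \subset ~: y & #|q| == r - s]]|)%N.
Proof.
move=> sr; rewrite -cardsX.
have sp (p q : {set T}) : p \subset y -> q \subset ~: y ->
    (p :|: q) :&: y = p /\ (p :|: q) :\: y = q.
  move=> py qy; split.
    rewrite setIUl (setIidPl py) disjoint_setI0 ?setU0 //.
    by rewrite disjoints_subset.
  move: py; rewrite -setD_eq0 setDUl => /eqP ->; rewrite set0U.
  by apply/setDidPl; rewrite disjoints_subset.
set D := setX _ _.
rewrite -(card_in_imset (f := fun pq : {set T} * {set T} => pq.1 :|: pq.2) (D := mem D)); last first.
  move=> [p q] [p' q']; rewrite !inE /=.
  move=> /andP[/and3P[_ py _] /and3P[_ qy _]] /andP[/and3P[_ py' _] /and3P[_ qy' _]] E.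
  have [e1 e2] := sp _ _ py qy; have [e3 e4] := sp _ _ py' qy'.
  by congr pair; [rewrite -e1 E e3 | rewrite -e2 E e4].
apply: eq_card => x; rewrite !inE; apply/and3P/imsetP.
  move=> [/eqP xr ux /eqP xs]; exists (x :&: y, x :\: y); last by rewrite /= setID.
  rewrite !inE /= setSI // subsetIr xs eqxx setSD //= -xs -xr.
  by rewrite -[#|x|](cardsID y x) addKn eqxx andbT setDE subsetIr.
move=> [[p q]]; rewrite !inE /=.
move=> /andP[/and3P[up py /eqP ps] /and3P[uq qy /eqP qs]] ->.
have [e1 e2] := sp _ _ py qy; split; last by rewrite e1 ps.
  by rewrite -(cardsID y) e1 e2 ps qs subnKC.
by rewrite -(setID u y) setUSS.
Qed.

End SubsetCounting.

(* The number of b-subsets of an a-set that contain a given d-subset; the guard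
   is needed because truncated subtraction would give 1 when d > b. *)
Definition bin_above (a b d : nat) : nat := if (d <= b)%N then 'C(a - d, b - d) else 0%N.

(* The number of r-subsets x of an n-set with |x ∩ y| = s containing a given
   i-set u, where |y| = r and |u ∩ y| = k. *)
Definition meet_count (n r s i k : nat) : nat :=
  (bin_above r s k * bin_above (n - r) (r - s) (i - k))%N.

Lemma card_meet (n r s i : nat) (u y : {set 'I_n}) : (s <= r)%N ->
  #|u| = i -> #|y| = r ->
  #|[set x : {set 'I_n} | [&& #|x| == r, u \subset x & #|x :&: y| == s]]| =
  meet_count n r s i #|u :&: y|.
Proof.
move=> sr ui yr; rewrite card_meet_split // card_between ?subsetIr //.
rewrite card_between; last by rewrite setDE subsetIr.
rewrite (cardsCs (~: y)) setCK card_ord yr cardsD ui.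
by [].
Qed.

Section NewtonExpansion.
Variable V : zmodType.

Definition fdiff (f : nat -> V) (k : nat) : V := f k.+1 - f k.

(** Newton's forward difference formula. The induction applies it to [f \o S] and recombines with
    Pascal's rule. *)
Lemma newton_expansion f k :
  f k = \sum_(m < k.+1) iter m fdiff f 0 *+ 'C(k, m).
Proof.
elim: k f => [|k IH] f; first by rewrite big_ord1 bin0.
have E m j : iter m fdiff (f \o S) j = iter m fdiff f j.+1.
  by elim: m j => //= m IHm j; rewrite /fdiff !IHm.
have := IH (f \o S) => /= ->.
rewrite [RHS]big_ord_recl /= bin0 mulr1n.
under [X in _ = _ + X]eq_bigr do rewrite binS mulrnDr.
rewrite big_split /= addrA.
have -> : f 0 + \sum_(i < k.+1) iter i.+1 fdiff f 0 *+ 'C(k, i.+1) =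
     \sum_(i < k.+1) iter i fdiff f 0 *+ 'C(k, i).
  by rewrite [RHS]big_ord_recl /= bin0 mulr1n big_ord_recr /= bin_small // mulr0n addr0.
rewrite -big_split /=; apply: eq_bigr => i _.
by rewrite E -mulrnDl /= /fdiff addrC subrK.
Qed.

End NewtonExpansion.

(** An m-th difference is an alternating binomial sum in which the top value has coefficient 1 and
    the other coefficients have absolute values adding up to 2^m - 1. The top value is kept apart
    because it will carry the main term of an eigenvalue. *)
Lemma fdiff_bound (R : numDomainType) (f : nat -> R) (M : R) k m :
  (forall l, (k <= l < k + m)%N -> `|f l| <= M) ->
  `|iter m (@fdiff R) f k - f (k + m)%N| <= ((2 ^ m - 1)%N)%:R * M.
Proof.
elim: m k => [|m IH] k H; first by rewrite addn0 subrr normr0 mul0r.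
have h1 := IH k.+1; have h2 := IH k.
rewrite /= /fdiff -/(fdiff _).
set a := iter m _ f k.+1; set b := iter m _ f k.
have -> : a - b - f (k + m.+1)%N =
   (a - f (k.+1 + m)%N) - (b - f (k + m)%N) - f (k + m)%N.
  by rewrite addSnnS; ring.
apply: le_trans (ler_normB _ _) _.
have -> : ((2 ^ m.+1 - 1)%N)%:R * M = ((2 ^ m - 1)%N)%:R * M + ((2 ^ m - 1)%N)%:R * M + M.
  have -> : (2 ^ m.+1 - 1 = (2 ^ m - 1) + (2 ^ m - 1) + 1)%N.
    by have := expn_gt0 2 m; rewrite expnS; lia.
  by rewrite !natrD; ring.
apply: lerD; last by apply: H; lia.
apply: le_trans (ler_normB _ _) _; apply: lerD.
  by apply: h1 => l hl; apply: H; lia.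
by apply: h2 => l hl; apply: H; lia.
Qed.

(** * Spectrum of the generalized Johnson graph *)

Section JohnsonSpectrum.
Variables (F : numFieldType) (n : nat).

Definition jset k (z : 'I_#|jvert n k|) : {set 'I_n} := val (enum_val z).

Definition incmx i k : 'M[F]_(#|jvert n i|, #|jvert n k|) :=
  \matrix_(u, x) (jset u \subset jset x)%:R.

Lemma sum_jvert k (P : pred {set 'I_n}) :
  \sum_(z < #|jvert n k|) (P (jset z))%:R =
  #|[set x : {set 'I_n} | (#|x| == k) && P x]|%:R :> F.
Proof.
rewrite (reindex _ (onW_bij _ (@enum_rank_bij (jvert n k)))) /=.
under eq_bigr do rewrite /jset enum_rankK.
rewrite -sum1_card natr_sum [RHS]big_mkcond /=.
transitivity (\sum_(x in [pred x : {set 'I_n} | #|x| == k]) (P x)%:R : F).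
  rewrite [RHS](reindex_omap (fun x : jvert n k => val x) insub) /=.
    by apply: eq_bigl => -[x xk] /=; rewrite inE insubT xk /= eqxx.
  by move=> x; rewrite inE => xk; rewrite insubT.
rewrite big_mkcond /=; apply: eq_bigr => x _; rewrite !inE.
by case: eqP => //= _; case: (P x).
Qed.

Lemma card_jset k (z : 'I_#|jvert n k|) : #|jset z| = k.
Proof. by apply/eqP; rewrite /jset; case: (enum_val z). Qed.

(** Counts the k-sets between an i-set and an r-set. The coefficient is nonzero when k <= r, which
    makes the row spaces increase with i. *)
Lemma incmx_mul i k r : (i <= k)%N ->
  incmx i k *m incmx k r = ('C(r - i, k - i))%:R *: incmx i r.
Proof.
move=> ik; apply/matrixP => a b; rewrite !mxE.
set u := jset a; set y := jset b.
transitivity (\sum_(z < #|jvert n k|)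
    ([pred x : {set 'I_n} | (u \subset x) && (x \subset y)] (jset z))%:R : F).
  by apply: eq_bigr => z _; rewrite !mxE -natrM mulnb.
rewrite sum_jvert /=; case: (boolP (u \subset y)) => uy; last first.
  rewrite mulr0; apply/eqP; rewrite pnatr_eq0 cards_eq0; apply/eqP/setP => x.
  rewrite !inE; apply/negP => /and3P[_ ux xy].
  by move: uy; rewrite (fintype.subset_trans ux xy).
rewrite mulr1; congr (_%:R).
have := card_between k uy; rewrite !card_jset ik => <-.
by apply: eq_card => x; rewrite !inE; case: (#|x| == k); rewrite ?andbT ?andbF.
Qed.

Lemma incmx_id k : incmx k k = 1%:M.
Proof.
apply/matrixP => a b; rewrite !mxE; congr (_%:R); congr nat_of_bool.
rewrite -(inj_eq enum_val_inj) -val_eqE /=.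
by rewrite eqEcard !card_jset leqnn andbT.
Qed.

Lemma incmx_sub i k r : (i <= k <= r)%N -> (incmx i r <= incmx k r)%MS.
Proof.
move=> /andP[ik kr].
have c0 : ('C(r - i, k - i))%:R != 0 :> F by rewrite pnatr_eq0 -lt0n bin_gt0 leq_sub2r.
by rewrite -(eqmx_scale (incmx i r) c0) -incmx_mul // submxMl.
Qed.

(** These entries are the basis functions of Newton's formula in the intersection size. *)
Lemma tr_incmx_mul m i r a b :
  ((incmx m i)^T *m incmx m r) a b =
  ('C(#|jset a :&: jset b|, m))%:R.
Proof.
rewrite !mxE; set u := jset a; set y := jset b.
transitivity (\sum_(z < #|jvert n m|)
    ([pred x : {set 'I_n} | (x \subset u) && (x \subset y)] (jset z))%:R : F).
  by apply: eq_bigr => z _; rewrite !mxE -natrM mulnb.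
rewrite sum_jvert -cards_draws; congr (_%:R).
by apply: eq_card => x; rewrite !inE subsetI andbC.
Qed.

Variables (r s : nat).
Hypothesis sr : (s < r)%N.

(** The coefficient of the top term m = i in the Newton expansion of [incmx i r *m A]. *)
Definition johnson_eigen i : F :=
  iter i (@fdiff F) (fun k => (meet_count n r s i k)%:R) 0.

(* Shifted by one: the i-th space is spanned by the rows of W_(i-1). *)
Definition johnson_flag i : 'M[F]_#|jvert n r| :=
  if i is i'.+1 then <<incmx i' r>>%MS else 0.

(** The dimension of the i-th successive quotient of the flag, taken in [F] so that the subtraction
    is not truncated. *)
Definition johnson_mult i : F :=
  (\rank (johnson_flag i.+1))%:R - (\rank (johnson_flag i))%:R.

Local Notation A := (adjmx F (@jadj n r s)).

Lemma incmx_adjE i a b :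
  (incmx i r *m A) a b =
  (meet_count n r s i #|jset a :&: jset b|)%:R.
Proof.
rewrite !mxE; set u := jset a; set y := jset b.
transitivity (\sum_(z < #|jvert n r|)
    ([pred x : {set 'I_n} | (u \subset x) && (#|x :&: y| == s)] (jset z))%:R : F).
  by apply: eq_bigr => z _; rewrite !mxE -natrM mulnb.
rewrite sum_jvert; congr (_%:R).
by rewrite -(card_meet (ltnW sr) (card_jset a) (card_jset b)).
Qed.

Lemma incmx_adj i :
  incmx i r *m A = \sum_(m < i.+1)
    iter m (@fdiff F) (fun k => (meet_count n r s i k)%:R) 0 *:
      ((incmx m i)^T *m incmx m r).
Proof.
apply/matrixP => a b; rewrite incmx_adjE summxE.
set k := #|_|; have ki : (k <= i)%N.
  by rewrite -[X in (_ <= X)%N](card_jset a) subset_leq_card ?subsetIl.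
rewrite (newton_expansion (fun k => (meet_count n r s i k)%:R : F)).
pose c m := iter m (@fdiff F) (fun k => (meet_count n r s i k)%:R) 0.
rewrite (big_ord_widen i.+1 (fun m => c m *+ 'C(k, m))) // big_mkcond /=.
apply: eq_bigr => m _; rewrite mxE tr_incmx_mul -/k mulr_natr ltnS.
by case: leqP => // km; rewrite bin_small.
Qed.

Lemma johnson_flagP i : (i <= r)%N ->
  (johnson_flag i.+1 *m (A - (johnson_eigen i)%:M) <= johnson_flag i)%MS.
Proof.
move=> ir.
have E : incmx i r *m (A - (johnson_eigen i)%:M) =
   \sum_(m < i) iter m (@fdiff F) (fun k => (meet_count n r s i k)%:R) 0 *:
      ((incmx m i)^T *m incmx m r).
  (* Since [incmx i i] is the identity, the term m = i is exactly the eigenvalue times [incmx i r]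
     and cancels. *)
  rewrite mulmxBr incmx_adj big_ord_recr /= incmx_id trmx1 mul1mx.
  by rewrite mul_mx_scalar addrK.
have /submxP[D ->] : (johnson_flag i.+1 <= incmx i r)%MS by rewrite genmxE.
rewrite -mulmxA; apply: mulmx_sub; rewrite E.
apply: summx_sub => -[m /= mi] _; apply: scalemx_sub; apply: mulmx_sub.
case: i mi ir {E D} => // i mi ir.
by rewrite /johnson_flag genmxE incmx_sub // -ltnS mi ltnW.
Qed.

Lemma johnson_flag_mono i : (i <= r)%N -> (johnson_flag i <= johnson_flag i.+1)%MS.
Proof.
case: i => [|i] ir; first by rewrite {1}/johnson_flag sub0mx.
by rewrite !genmxE incmx_sub // leqnSn.
Qed.

Lemma homC_spectral t : (1 < t)%N ->
  (homC t n r s)%:R = \sum_(i < r.+1) johnson_mult i * johnson_eigen i ^+ t.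
Proof.
move=> t1; rewrite /homC (hom_cycle_trace F) //; last first.
  by move=> x y; rewrite /jadj setIC.
apply: (mxtrace_exp_flag (V := johnson_flag)) => //.
- by rewrite -sub1mx genmxE incmx_id submx_refl.
- by move=> i ir; apply: johnson_flag_mono.
by move=> i ir; apply: johnson_flagP.
Qed.

Lemma card_jvert k : #|jvert n k| = 'C(n, k).
Proof.
transitivity 'C(#|'I_n|, k); last by rewrite card_ord.
by rewrite -card_draws card_sig; apply: eq_card => x; rewrite !inE.
Qed.

Lemma rank_incmx_le i : (\rank (incmx i r) <= 'C(n, i))%N.
Proof. by rewrite -card_jvert rank_leq_row. Qed.

Lemma rank_incmx_ge i : (i <= r <= n)%N -> ('C(n - r + i, i) <= \rank (incmx i r))%N.
Proof.
move=> /andP[ir rn].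
have [z zc] : exists z : {set 'I_n}, #|z| = (r - i)%N.
  have : (0 < #|[set z : {set 'I_n} | #|z| == (r - i)%N]|)%N.
    by rewrite card_draws card_ord bin_gt0 leq_subLR (leq_trans rn) ?leq_addl.
  by case/card_gt0P => z; rewrite inE => /eqP; exists z.
(* [L] selects the rows u in [S] and [M] the columns v :|: z with v in [S]. As u avoids z, u lies in
   v :|: z iff it lies in v, that is, iff u = v by cardinality; so the selected submatrix is the
   identity. *)
pose S := {u : {set 'I_n} | (u \subset ~: z) && (#|u| == i)}.
pose L : 'M[F]_(#|{: S}|, #|jvert n i|) :=
  \matrix_(a, b) (jset b == val (enum_val a))%:R.
pose M : 'M[F]_(#|jvert n r|, #|{: S}|) :=
  \matrix_(b, a) (jset b == val (enum_val a) :|: z)%:R.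
have Sz (u : S) : [disjoint val u & z].
  by have /andP[+ _] := valP u; rewrite -disjoints_subset.
have Sc (u : S) : #|val u| = i by have /andP[_ /eqP] := valP u.
have delta k (x : {set 'I_n}) (G : pred {set 'I_n}) : #|x| = k ->
    \sum_(c < #|jvert n k|) ([pred y | (y == x) && G y] (jset c))%:R = (G x)%:R :> F.
  move=> xk; rewrite sum_jvert; case: (boolP (G x)) => Gx.
    apply: (congr1 (fun k => k%:R)); rewrite -[RHS]/1%N -(cards1 x); apply: eq_card => y; rewrite !inE.
    by case: (y =P x) => [->|_]; rewrite ?xk ?eqxx ?Gx ?andbF.
  apply/eqP; rewrite pnatr_eq0 cards_eq0; apply/eqP/setP => y; rewrite !inE.
  by case: (y =P x) => [->|_]; rewrite ?(negbTE Gx) ?andbF.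
have LWM : L *m incmx i r *m M = 1%:M.
  apply/matrixP => a b; rewrite -mulmxA !mxE.
  transitivity (\sum_(c < #|jvert n i|) ([pred y | (y == val (enum_val a)) &&
       (y \subset val (enum_val b) :|: z)] (jset c))%:R : F).
    apply: eq_bigr => c _; rewrite !mxE.
    rewrite -[RHS]/((_ && _)%:R) -mulnb natrM; congr (_ * _).
    rewrite -(delta r _ (fun x => jset c \subset x)); last first.
      rewrite cardsU disjoint_setI0 ?Sz // cards0 subn0 zc Sc subnKC //.
    apply: eq_bigr => d _; rewrite !mxE -natrM mulnb /=.
    by rewrite andbC.
  rewrite (delta i (val (enum_val a)) (fun y => y \subset val (enum_val b) :|: z)) ?Sc //.
  congr (_%:R); congr nat_of_bool.
  rewrite -(inj_eq enum_val_inj) -val_eqE eqEcard !Sc leqnn andbT.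
  apply/idP/idP => [ab|]; last by move=> h; apply: fintype.subset_trans h (subsetUl _ _).
  apply/fintype.subsetP => x xa; have := fintype.subsetP ab x xa; rewrite inE => /orP[//|xz].
  by have /disjointFr := Sz (enum_val a); move/(_ x xa); rewrite xz.
have -> : 'C(n - r + i, i) = #|{: S}|.
  rewrite card_sig.
  have -> : (n - r + i = #|~: z|)%N.
    by rewrite cardsCs setCK card_ord zc subnBA // addnBAC.
  by rewrite -cards_draws; apply: eq_card => x; rewrite !inE.
rewrite -[leqLHS](@mxrank1 F) -LWM.
by apply: leq_trans (mxrankM_maxl _ _) (mxrankM_maxr _ _).
Qed.

(** All row sums of A are N_1, so those of A^t are N_1^t; entries are nonnegative, hence each
    diagonal entry is at most its row sum. This crude bound serves the finitely many small n. *)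
Lemma mxtrace_adj_exp_le t :
  \tr (A ^+ t) <= (#|jvert n r|)%:R * (N1 n r s)%:R ^+ t.
Proof.
pose one : 'cV[F]_#|jvert n r| := const_mx 1.
have Aone : A *m one = (N1 n r s)%:R *: one.
  apply/matrixP => a b; rewrite !mxE mulr1; set x := jset a.
  transitivity (\sum_(z < #|jvert n r|)
    ([pred y : {set 'I_n} | (set0 \subset y) && (#|y :&: x| == s)] (jset z))%:R : F).
    by apply: eq_bigr => z _; rewrite !mxE mulr1 /= sub0set setIC.
  rewrite sum_jvert (card_meet (ltnW sr) (cards0 _) (card_jset a)).
  by rewrite set0I cards0 /meet_count /bin_above /= !subn0.
have Atone : A ^+ t *m one = (N1 n r s)%:R ^+ t *: one.
  elim: t => [|t IH]; first by rewrite !expr0 mul1mx scale1r.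
  by rewrite exprSr -mulmxE -mulmxA Aone -scalemxAr IH scalerA -exprS.
have Age a b : 0 <= (A ^+ t) a b.
  elim: t a b {Atone} => [|t IH] a b; first by rewrite expr0 mxE ler0n.
  by rewrite exprS -mulmxE mxE sumr_ge0 // => c _; rewrite mulr_ge0 // mxE ler0n.
rewrite /mxtrace mulr_natl -[X in _ *+ X]card_ord -sumr_const ler_sum // => a _.
have : (A ^+ t *m one) a 0 = (N1 n r s)%:R ^+ t by rewrite Atone !mxE mulr1.
move=> <-; rewrite mxE (bigD1 a) //= mxE mulr1 lerDl.
by apply: sumr_ge0 => b _; rewrite mxE mulr1.
Qed.

Lemma homC_le t : (1 < t)%N ->
  (homC t n r s)%:R <= ('C(n, r))%:R * (N1 n r s)%:R ^+ t :> F.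
Proof.
move=> t1; rewrite /homC (hom_cycle_trace F) //; last first.
  by move=> x y; rewrite /jadj setIC.
by rewrite -card_jvert mxtrace_adj_exp_le.
Qed.

End JohnsonSpectrum.

(** * Size of eigenvalues and multiplicities *)

Lemma leq_wexp2r e m n : (m <= n)%N -> (m ^ e <= n ^ e)%N.
Proof. by case: e => // e; rewrite leq_exp2r. Qed.

Lemma leq_ffact_exp n k : ((n.+1 - k) ^ k <= n ^_ k)%N.
Proof.
rewrite ffact_prod -[X in (_ ^ X <= _)%N](card_ord k) -prod_nat_const.
by apply: leq_prod => i _; have := ltn_ord i; lia.
Qed.

Lemma ffact_leq_exp n k : (n ^_ k <= n ^ k)%N.
Proof.
rewrite ffact_prod -[X in (_ <= _ ^ X)%N](card_ord k) -prod_nat_const.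
by apply: leq_prod => i _; rewrite leq_subr.
Qed.

Lemma bin_leq_exp n k : ('C(n, k) <= n ^ k)%N.
Proof.
by apply: leq_trans (ffact_leq_exp n k); rewrite -bin_ffact leq_pmulr ?fact_gt0.
Qed.

(** The count has order n^(r-s-(i-l)) and vanishes unless l <= s. With l < i this loses at least
    max(1, i-s) powers of n against the degree, which has order n^(r-s). *)
Lemma meet_count_le n r s i l : (0 < n)%N -> (s < r)%N -> (l < i <= r)%N ->
  (meet_count n r s i l <= r ^ r * n ^ (r - s - maxn 1 (i - s)))%N.
Proof.
move=> n0 sr /andP[li ir]; rewrite /meet_count /bin_above.
case: (leqP l s) => [ls|]; last by rewrite mul0n.
apply: leq_mul.
  apply: leq_trans (bin_leq_exp _ _) _.
  apply: (@leq_trans (r ^ (s - l))); first by rewrite leq_wexp2r ?leq_subr.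
  by rewrite leq_pexp2l; lia.
case: (leqP (i - l)) => // h; apply: leq_trans (bin_leq_exp _ _) _.
apply: (@leq_trans (n ^ (r - s - (i - l)))); last by rewrite leq_pexp2l; lia.
by rewrite leq_wexp2r; lia.
Qed.

(** Since n >= 4r, every factor of the falling factorial of n - r is at least n/2. This bounds N_1
    from below. *)
Lemma exp_leq_bin n r k : (k <= r)%N -> (4 * r <= n)%N ->
  (n ^ k <= 2 ^ k * k`! * 'C(n - r, k))%N.
Proof.
move=> kr rn; rewrite -mulnA [(k`! * _)%N]mulnC bin_ffact.
apply: (@leq_trans (2 ^ k * ((n - r).+1 - k) ^ k)%N).
  by rewrite -expnMn leq_wexp2r; lia.
by rewrite leq_mul2l leq_ffact_exp orbT.
Qed.

Lemma bernoulli_le (R : realDomainType) (u : R) k : 0 <= u <= 1 ->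
  1 - k%:R * u <= (1 - u) ^+ k.
Proof.
move=> /andP[u0 u1]; elim: k => [|k IH]; first by rewrite mul0r subr0 expr0.
have h0 : 0 <= 1 - u by rewrite subr_ge0.
rewrite exprS; apply: le_trans (ler_wpM2l h0 IH).
have : 0 <= k%:R * u * u by rewrite !mulr_ge0.
by rewrite -natr1; nra.
Qed.

Section EigenvalueAsymptotics.
Variables (R : realFieldType) (r s : nat).
Hypothesis sr : (s < r)%N.

Local Notation lam n i := (johnson_eigen R n r s i).
Local Notation rho j := ('C(r - j, s - j)%:R / 'C(r, s)%:R : R).

Lemma N1_gt0 n : (4 * r <= n)%N -> (0 < N1 n r s)%N.
Proof. by move=> rn; rewrite /N1 muln_gt0 !bin_gt0 (ltnW sr) /=; lia. Qed.

Lemma johnson_eigen0 n : lam n 0 = (N1 n r s)%:R.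
Proof. by rewrite /johnson_eigen /= /meet_count /bin_above /= !subn0. Qed.

(** The factors come from [fdiff_bound], [meet_count_le] and [exp_leq_bin], in this order. *)
Let K1 : R := (2 ^ r * r ^ r * (2 ^ r * r`!))%:R.

(** The top value of the difference, divided by N_1, equals the limit exactly (0 if i > s); the
    lower values form the error. For i <= s the truncated [i - s] is 0 and the exponent is 1. *)
Lemma johnson_eigen_asymp n i : (0 < n)%N -> (4 * r <= n)%N -> (i <= r)%N ->
  `|lam n i / (N1 n r s)%:R - (if (i <= s)%N then rho i else 0)|
     <= K1 / n%:R ^+ maxn 1 (i - s).
Proof.
move=> n0 rn ir; set d := maxn _ _.
have N10 : 0 < (N1 n r s)%:R :> R by rewrite ltr0n N1_gt0.
have nR0 : 0 < n%:R :> R by rewrite ltr0n.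
set f := fun k => (meet_count n r s i k)%:R : R.
have fi : f i / (N1 n r s)%:R = if (i <= s)%N then rho i else 0.
  rewrite /f /meet_count /bin_above; case: (leqP i s) => _; last by rewrite mul0n mul0r.
  rewrite subnn /= !subn0 /N1 !natrM -mulf_div divff ?mulr1 //.
  by rewrite pnatr_eq0 -lt0n bin_gt0; lia.
rewrite -fi -mulrBl normrM normfV (gtr0_norm N10) ler_pdivrMr //.
have := @fdiff_bound R f (r ^ r * n ^ (r - s - d))%:R 0 i.
rewrite add0n; move=> /(_ _) H.
apply: le_trans (H _) _.
  move=> l li; rewrite /f normr_nat ler_nat meet_count_le //.
  by move: li; rewrite leq0n /= => ->.
rewrite /K1 mulrAC ler_pdivlMr ?exprn_gt0 // -natrX -!natrM ler_nat.
have E : (n ^ (r - s - d) * n ^ d = n ^ (r - s))%N.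
  by rewrite -expnD subnK //; rewrite /d; lia.
rewrite -!mulnA E.
apply: leq_mul.
  by apply: leq_trans (leq_subr _ _) _; rewrite leq_pexp2l.
rewrite leq_mul2l; apply/orP; right.
apply: leq_trans (exp_leq_bin (leq_subr s r) rn) _; rewrite -mulnA.
apply: leq_mul; first by rewrite leq_pexp2l ?leq_subr.
apply: leq_mul; first by rewrite leq_fact ?leq_subr.
by rewrite /N1 leq_pmull // bin_gt0 ltnW.
Qed.

End EigenvalueAsymptotics.

Section MultiplicityAsymptotics.
Variables (R : realFieldType) (r : nat).
Local Notation mult n i := (johnson_mult R n r i).

Lemma johnson_mult0 n : (r <= n)%N -> mult n 0 = 1.
Proof.
move=> rn; rewrite /johnson_mult [johnson_flag _ _ _ 0]/johnson_flag mxrank0 subr0.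
rewrite genmxE; suff -> : \rank (incmx R n 0 r) = 1%N by [].
apply/eqP; rewrite eqn_leq (leq_trans (rank_incmx_le _ _ _ _)) ?bin0 //.
by have := @rank_incmx_ge R n r 0; rewrite rn bin0; apply.
Qed.

Lemma johnson_mult_ge0 n i : (i <= r)%N -> 0 <= mult n i.
Proof.
by move=> ir; rewrite subr_ge0 ler_nat mxrankS // johnson_flag_mono.
Qed.

Lemma johnson_mult_le n i : mult n i <= ('C(n, i))%:R.
Proof.
rewrite /johnson_mult lerBlDr -natrD ler_nat genmxE.
by rewrite (leq_trans (rank_incmx_le _ _ _ _)) ?leq_addr.
Qed.

(** r * r comes from Bernoulli's inequality for (1 - r/n)^i, and r! from subtracting the rank of the
    previous space, which is at most n^(i-1). *)
Let K2 : R := (r * r + r`!)%:R.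

Lemma johnson_mult_asymp n i : (0 < n)%N -> (r <= n)%N -> (i <= r)%N ->
  `|mult n i * (i`!)%:R / n%:R ^+ i - 1| <= K2 / n%:R.
Proof.
move=> n0 rn ir.
have nR0 : 0 < n%:R :> R by rewrite ltr0n.
have K20 : 0 <= K2 / n%:R by rewrite divr_ge0 ?ler0n.
have up : mult n i * (i`!)%:R / n%:R ^+ i <= 1.
  rewrite ler_pdivrMr ?exprn_gt0 // mul1r.
  apply: (@le_trans _ _ ('C(n, i) * i`!)%:R).
    by rewrite natrM ler_wpM2r ?ler0n ?johnson_mult_le.
  by rewrite bin_ffact -natrX ler_nat ffact_leq_exp.
rewrite ler_norml; apply/andP; split; last first.
  by rewrite lerBlDr (le_trans up) // lerDr.
case: i ir up => [|i] ir up.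
  by rewrite johnson_mult0 // mul1r divr1 subrr oppr_le0.
have lo : (n - r)%:R ^+ i.+1 - (r`!)%:R * n%:R ^+ i <= mult n i.+1 * (i.+1`!)%:R :> R.
  rewrite /johnson_mult mulrBl; apply: lerB.
    rewrite genmxE -natrX -natrM ler_nat.
    apply: (@leq_trans ('C(n - r + i.+1, i.+1) * i.+1`!)).
      rewrite bin_ffact; apply: leq_trans (leq_ffact_exp _ _).
      by rewrite leq_wexp2r; lia.
    by rewrite leq_mul2r rank_incmx_ge ?orbT // ir.
  rewrite genmxE -natrX -!natrM ler_nat mulnC leq_mul ?leq_fact //.
  by apply: leq_trans (rank_incmx_le _ _ _ _) (bin_leq_exp _ _).
have B := @bernoulli_le R (r%:R / n%:R) i.+1.
have u01 : 0 <= (r%:R / n%:R : R) <= 1.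
  by rewrite divr_ge0 ?ler0n //= ler_pdivrMr // mul1r ler_nat.
have {B} := B u01.
have -> : 1 - r%:R / n%:R = (n - r)%:R / n%:R :> R.
  by rewrite natrB // mulrBl divff ?gt_eqF.
move=> B.
have {}lo : (n - r)%:R ^+ i.+1 / n%:R ^+ i.+1 - (r`!)%:R / n%:R <=
    mult n i.+1 * (i.+1`!)%:R / n%:R ^+ i.+1.
  have -> : (r`!)%:R / n%:R = (r`!)%:R * n%:R ^+ i / n%:R ^+ i.+1 :> R.
    by rewrite exprS -mulf_div divff ?mulr1 ?expf_neq0 ?gt_eqF.
  by rewrite -mulrBl ler_wpM2r ?invr_ge0 ?exprn_ge0 ?ler0n.
rewrite lerBrDl; apply: le_trans lo.
rewrite -expr_div_n lerBrDr; apply: le_trans B.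
rewrite /K2 natrD mulrDl natrM.
have : (i.+1)%:R * (r%:R / n%:R) <= r%:R * r%:R / n%:R :> R.
  by rewrite -mulrA ler_wpM2r ?ler_nat //; case/andP: u01.
lra.
Qed.

End MultiplicityAsymptotics.

(** * Moving relative errors into t-th powers *)

Lemma powR_root (R : realType) (mu : R) t : (0 < t)%N -> 0 <= mu ->
  (mu `^ t%:R^-1) ^+ t = mu.
Proof.
move=> t0 mu0; rewrite -powR_mulrn ?powR_ge0 // -powRrM mulVf ?powRr1 //.
by rewrite pnatr_eq0 -lt0n.
Qed.

(** Raising to the power t moves a nonnegative number away from 1, on whichever side of 1 it
    lies. *)
Lemma powR_root_near1 (R : realType) (mu : R) t : (0 < t)%N -> 0 <= mu ->
  `|mu `^ t%:R^-1 - 1| <= `|mu - 1|.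
Proof.
move=> t0 mu0; have := powR_root t0 mu0; have := powR_ge0 mu t%:R^-1.
set nu := mu `^ _ => nu0 <-.
case: (leP nu 1) => nu1.
  rewrite ler0_norm ?subr_le0 // ler0_norm ?subr_le0 ?exprn_ile1 //.
  by rewrite lerN2 lerD2r ler_iXnr.
have {}nu1 := ltW nu1.
rewrite ger0_norm ?subr_ge0 // ger0_norm ?subr_ge0 ?exprn_ege1 //.
by rewrite lerD2r ler_eXnr.
Qed.

Section Absorption.
Variables (R : realType) (r s : nat) (K c : R) (rho : nat -> R).
Hypotheses (sr : (s < r)%N) (c0 : 0 < c) (K1 : 1 <= K).
Hypothesis rho_bnd : forall i, (i <= s)%N -> c <= rho i <= 1.

(** [Q] bounds |e_i / e_s| n^(i-s) for i > s, as e_s >= c/2. [K'] adds to the multiplicity error [K]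
    the bound for the relative weight of all terms beyond s. *)
Let Q := 2 * K / c.
Let K' := K + (r.+1)%:R * ((s`!)%:R * Q ^+ 2).

(* The terms with i > s go into the term i = s, and the factors 1 + O(1/n) into
   the t-th powers. *)
Lemma absorb_spectrum (n t : nat) (D e : nat -> R) :
  (0 < n)%N -> Q + 2 * K' <= n%:R -> (1 < t)%N ->
  D 0 = 1 -> e 0 = 1 ->
  (forall i, (i <= s)%N -> `|e i - rho i| <= K / n%:R) ->
  (forall i, (s < i <= r)%N -> `|e i| <= K / n%:R ^+ (i - s)) ->
  (forall i, (i <= s)%N -> `|D i * (i`!)%:R / n%:R ^+ i - 1| <= K / n%:R) ->
  (forall i, (i <= r)%N -> 0 <= D i <= n%:R ^+ i) ->
  exists delta : nat -> R,
    (forall j, (j <= s)%N -> `|delta j| <= (K' * (1 + K) + K) / n%:R) /\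
    \sum_(i < r.+1) D i * e i ^+ t =
      1 + delta 0 + \sum_(1 <= j < s.+1)
        (n%:R ^+ j / (j`!)%:R) * (rho j + delta j) ^+ t.
Proof.
move=> n0 nK t1 D0 e0 erho etail Dasy Dbnd.
set x := n%:R : R in nK erho etail Dasy Dbnd *.
have x0 : 0 < x by rewrite ltr0n.
have x1 : 1 <= x by rewrite ler1n.
have K0 : 0 < K by apply: lt_le_trans K1.
have Q0 : 0 < Q by rewrite /Q divr_gt0 // mulr_gt0.
have [Q0' x0' K0' c0'] : [/\ 0 <= Q, 0 <= x, 0 <= K & 0 <= c] by split; apply: ltW.
have KK' : K <= K' by rewrite /K' lerDl !mulr_ge0 ?exprn_ge0 ?invr_ge0.
have K'0 : 0 < K' by apply: lt_le_trans KK'.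
have K'0' := ltW K'0.
have xQ : Q <= x by apply: le_trans nK; rewrite lerDl mulr_ge0.
have xK' : 2 * K' <= x by apply: le_trans nK; rewrite lerDr.
have Kxc : K / x <= c / 2.
  by move: xQ; rewrite /Q !ler_pdivrMr // => h; lra.
have Kx1 : K / x <= K by rewrite ler_pdivrMr // ler_peMr.
have e_gt i : (i <= s)%N -> c / 2 <= e i.
  move=> hi; have /andP[h _] := rho_bnd hi; have := erho i hi.
  by rewrite ler_norml => /andP[h1 _]; lra.
have e_le i : (i <= s)%N -> `|e i| <= 1 + K.
  move=> hi; have /andP[h h'] := rho_bnd hi; have := erho i hi.
  rewrite ler_norml => /andP[h1 h2]; rewrite ger0_norm; first by lra.
  by apply: le_trans (e_gt i hi); rewrite divr_ge0.
have es0 : 0 < e s by apply: lt_le_trans (e_gt s (leqnn s)); rewrite divr_gt0.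
(* The terms beyond s, relative to n^s/s! e_s^t. *)
pose tail := (s`!)%:R / x ^+ s * \sum_(s.+1 <= i < r.+1) D i * (e i / e s) ^+ t.
have tail_le : `|tail| <= (r.+1)%:R * ((s`!)%:R * Q ^+ 2) / x.
  rewrite /tail mulr_sumr; apply: le_trans (ler_norm_sum _ _ _) _.
  apply: (@le_trans _ _ (\sum_(s.+1 <= i < r.+1) (s`!)%:R * Q ^+ 2 / x)); last first.
    rewrite sumr_const_nat -[leLHS]mulr_natl -[leRHS]mulrA ler_wpM2r ?ler_nat ?leq_subr //.
    by rewrite !mulr_ge0 ?exprn_ge0 ?invr_ge0.
  rewrite big_nat_cond [leRHS]big_nat_cond; apply: ler_sum => i.
  rewrite andbT => /andP[si ir]; rewrite ltnS in ir.
  have /andP[Di0 Di] := Dbnd i ir.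
  pose y := x ^+ (i - s).
  have y0 : 0 < y by rewrite exprn_gt0.
  have y0' := ltW y0.
  have xy : x <= y by rewrite /y ler_eXnr // subn_gt0.
  have q : `|e i / e s| <= Q / y.
    rewrite normrM normfV (gtr0_norm es0) ler_pdivrMr //.
    apply: le_trans (etail i _) _; first by rewrite si.
    rewrite -/y mulrAC ler_wpM2r ?invr_ge0 ?(ltW y0) //.
    have := ler_wpM2l (ltW Q0) (e_gt s (leqnn s)).
    by rewrite /Q; have -> : 2 * K / c * (c / 2) = K by field; rewrite gt_eqF.
  (* Here t >= 2 matters: the multiplicity is at most x^s y, and only a square leaves y (Q/y)^2 =
     Q^2/y, which is O(1/n). *)
  have qt : `|e i / e s| ^+ t <= (Q / y) ^+ 2.
    apply: (@le_trans _ _ ((Q / y) ^+ t)); first by apply: lerXn2r q; rewrite nnegrE ?normr_ge0 // divr_ge0.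
    have Qy0 : 0 <= Q / y by apply: divr_ge0.
    have Qy1 : Q / y <= 1 by rewrite ler_pdivrMr // mul1r (le_trans xQ).
    exact: ler_wiXn2l.
  rewrite !normrM normfV !normrX normr_nat (ger0_norm Di0) (ger0_norm (ltW x0)).
  rewrite -[leLHS]mulrA -[leRHS]mulrA; apply: ler_wpM2l => //.
  apply: (@le_trans _ _ (x ^- s * (x ^+ i * (Q / y) ^+ 2))).
    rewrite ler_wpM2l ?invr_ge0 ?exprn_ge0 ?(ltW x0) //.
    by rewrite ler_pM // exprn_ge0.
  have -> : x ^+ i = x ^+ s * y by rewrite /y -exprD subnKC // ltnW.
  rewrite -mulrA mulKf ?expf_neq0 ?gt_eqF //.
  have -> : y * (Q / y) ^+ 2 = Q ^+ 2 / y by field; rewrite gt_eqF.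
  by rewrite ler_wpM2l ?exprn_ge0 ?(ltW Q0) // lef_pV2 ?posrE.
pose mu j := D j * (j`!)%:R / x ^+ j + (if j == s then tail else 0).
have mu1 j : (j <= s)%N -> `|mu j - 1| <= K' / x.
  move=> js; rewrite /mu addrAC; apply: le_trans (ler_normD _ _) _.
  rewrite /K' [leRHS]mulrDl; apply: lerD; first exact: Dasy.
  case: eqP => // _; rewrite normr0.
  by rewrite !mulr_ge0 ?exprn_ge0 ?invr_ge0.
(* Keeps every [mu j] nonnegative, so that its t-th root exists. *)
have K'x : K' / x <= 1 / 2 by rewrite ler_pdivrMr //; lra.
have mu0 j : (j <= s)%N -> 0 <= mu j.
  by move=> /mu1; rewrite ler_norml => /andP[h _]; lra.
pose nu j := mu j `^ t%:R^-1.
(* The error of index 0 stands outside any t-th power, so it takes [mu 0] itself rather than its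
   root. *)
pose delta j := if j == 0%N then mu 0 - 1 else nu j * e j - rho j.
have t0 : (0 < t)%N by apply: ltnW.
exists delta; split=> [j js|].
  rewrite /delta; case: eqP => [_|_].
    apply: le_trans (mu1 0 _) _ => //; rewrite ler_wpM2r ?invr_ge0 ?(ltW x0) //.
    by nra.
  have -> : nu j * e j - rho j = (nu j - 1) * e j + (e j - rho j) by ring.
  apply: le_trans (ler_normD _ _) _; rewrite [leRHS]mulrDl; apply: lerD; last exact: erho.
  rewrite normrM mulrAC.
  apply: ler_pM => //; last exact: e_le.
  exact: le_trans (powR_root_near1 t0 (mu0 j js)) (mu1 j js).
pose G j := x ^+ j / (j`!)%:R * (mu j * e j ^+ t).
have GE j : (j < s)%N -> G j = D j * e j ^+ t.
  move=> js; rewrite /G /mu (ltn_eqF js) addr0.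
  by field; rewrite ?(gt_eqF es0) ?expf_neq0 ?gt_eqF ?ltr0n ?fact_gt0.
have Gs : G s = D s * e s ^+ t + \sum_(s.+1 <= i < r.+1) D i * e i ^+ t.
  have -> : \sum_(s.+1 <= i < r.+1) D i * e i ^+ t =
            (\sum_(s.+1 <= i < r.+1) D i * (e i / e s) ^+ t) * e s ^+ t.
    rewrite mulr_suml; apply: eq_bigr => i _.
    by rewrite expr_div_n -!mulrA mulVf ?mulr1 ?expf_neq0 ?gt_eqF.
  rewrite /G /mu eqxx /tail; set S := \sum_(_ <= _ < _) _.
  by field; rewrite ?(gt_eqF es0) ?expf_neq0 ?gt_eqF ?ltr0n ?fact_gt0.
transitivity (\sum_(0 <= j < s.+1) G j).
  rewrite -(big_mkord xpredT (fun i => D i * e i ^+ t)) (@big_cat_nat _ _ _ s.+1) //=; last exact: ltnW.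
  rewrite [X in X + _]big_nat_recr //= [RHS]big_nat_recr //= Gs addrA; congr (_ + _ + _).
  by rewrite !big_mkord; apply: eq_bigr => i _; rewrite GE.
rewrite big_ltn //; congr (_ + _).
  by rewrite /G /delta /= expr0 fact0 divr1 mul1r e0 expr1n mulr1 addrC subrK.
rewrite big_nat_cond [RHS]big_nat_cond; apply: eq_bigr => j /andP[/andP[j0 js] _].
rewrite /G /delta gtn_eqF // [rho j + _]addrC subrK exprMn powR_root //.
exact: mu0.
Qed.

End Absorption.

(** * The expansion of the homomorphism count *)

Definition eigen_ratio (R : fieldType) (r s j : nat) : R :=
  'C(r - j, s - j)%:R / 'C(r, s)%:R.

Section EigenRatio.
Variables (R : numFieldType) (r s : nat).
Hypothesis sr : (s < r)%N.
Local Notation rho := (eigen_ratio R r s).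

Lemma eigen_ratio0 : rho 0 = 1.
Proof. by rewrite /eigen_ratio !subn0 divff // pnatr_eq0 -lt0n bin_gt0 ltnW. Qed.

Lemma eigen_ratioS j : (j < s)%N -> rho j.+1 = rho j * ((s - j)%:R / (r - j)%:R).
Proof.
move=> js; rewrite /eigen_ratio.
have E : ((r - j) * 'C(r - j.+1, s - j.+1) = (s - j) * 'C(r - j, s - j))%N.
  by have := mul_bin_diag (r - j) (s - j.+1); rewrite -subnS (_ : (s - j.+1).+1 = s - j)%N //; lia.
have rj0 : (r - j)%:R != 0 :> R by rewrite pnatr_eq0; lia.
have -> : 'C(r - j.+1, s - j.+1)%:R = (s - j)%:R * 'C(r - j, s - j)%:R / (r - j)%:R :> R.
  by apply: (canRL (mulfK rj0)); rewrite -!natrM mulnC E.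
by rewrite [RHS]mulrACA -[LHS]mulrA; congr (_ * _); exact: mulrC.
Qed.

Lemma eigen_ratio_ge j : (j <= s)%N -> 'C(r, s)%:R^-1 <= rho j.
Proof.
move=> js; rewrite /eigen_ratio -[leLHS]mul1r ler_wpM2r ?invr_ge0 ?ler0n //.
by rewrite ler1n bin_gt0 leq_sub2r // ltnW.
Qed.

Lemma eigen_ratio_gt0 j : (j <= s)%N -> 0 < rho j.
Proof.
move=> js; apply: lt_le_trans (eigen_ratio_ge js).
by rewrite invr_gt0 ltr0n bin_gt0 ltnW.
Qed.

Lemma eigen_ratio_le1 j : (j <= s)%N -> rho j <= 1.
Proof.
elim: j => [|j IH] js; first by rewrite eigen_ratio0.
rewrite eigen_ratioS //; apply: mulr_ile1; rewrite ?IH ?(ltnW js) ?divr_ge0 ?ler0n //.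
by rewrite ler_pdivrMr ?ltr0n ?mul1r ?ler_nat; lia.
Qed.

End EigenRatio.

Lemma hom_cycle_expansion (R : realType) (r s : nat) : (s < r)%N ->
  exists2 C : R, 0 < C & forall n t : nat, (1 <= n)%N -> (2 <= t)%N ->
     exists delta : nat -> R,
       (forall j, (j <= s)%N -> `|delta j| <= C / n%:R) /\
       (homC t n r s)%:R =
         (N1 n r s)%:R ^+ t *
         (1 + delta 0 +
          \sum_(1 <= j < s.+1)
             (n%:R ^+ j / (j`!)%:R) * (eigen_ratio R r s j + delta j) ^+ t).
Proof.
move=> sr.
pose Ka : R := (2 ^ r * r ^ r * (2 ^ r * r`!))%:R.
pose Kb : R := (r * r + r`!)%:R.
have [K [K1 KaK KbK]] : exists K : R, [/\ 1 <= K, Ka <= K & Kb <= K].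
  have Ka0 : 0 <= Ka by apply: ler0n.
  have Kb0 : 0 <= Kb by apply: ler0n.
  by exists (1 + Ka + Kb); split; lra.
have K0 : 0 <= K by apply: le_trans K1.
pose c : R := 'C(r, s)%:R^-1.
have c0 : 0 < c by rewrite invr_gt0 ltr0n bin_gt0 ltnW.
have rho_bnd i : (i <= s)%N -> c <= eigen_ratio R r s i <= 1.
  by move=> hi; rewrite eigen_ratio_ge // eigen_ratio_le1.
have absorb := absorb_spectrum sr c0 K1 rho_bnd.
move: absorb; set Q := 2 * K / c; set K' := K + _ => absorb.
have Q0 : 0 <= Q by rewrite divr_ge0 ?mulr_ge0 // ltW.
have K'0 : 0 <= K' by rewrite addr_ge0 // mulr_ge0 // mulr_ge0 // exprn_ge0.
(* Forgets the bodies of [Q] and [K']; only their signs matter from here on. *)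
move: Q K' Q0 K'0 absorb => Q K' Q0 K'0 absorb.
pose n0 := (Num.bound (Q + 2 * K') + 4 * r)%N.
(* The last summand covers n < n0, where the errors are bounded by n0^r + 1 and n0/n >= 1. *)
pose C := K' * (1 + K) + K + (n0 ^ r + 1)%:R * n0%:R.
have C0 : 0 < C.
  have h1 : 0 <= K' * (1 + K) by rewrite mulr_ge0 // addr_ge0.
  have h2 : 0 <= (n0 ^ r + 1)%:R * n0%:R :> R by rewrite mulr_ge0.
  by rewrite /C; lra.
exists C => // n t n1 t2.
have nR0 : 0 < n%:R :> R by rewrite ltr0n.
have [n0n|nn0] := leqP n0 n; last first.
  (* For bounded n, [delta j] cancels the j-th base and [delta 0] absorbs everything. *)
  pose h : R := (homC t n r s)%:R / (N1 n r s)%:R ^+ t.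
  have hE : (homC t n r s)%:R = (N1 n r s)%:R ^+ t * h.
    (* If the degree is 0, the quotient [h] is 0 by convention; this is consistent because [homC_le]
       then forces the count to be 0. *)
    rewrite /h; have [N0|N0] := eqVneq (N1 n r s) 0%N; last first.
      by rewrite mulrC divfK // expf_neq0 // pnatr_eq0.
    have := homC_le R n sr t2; rewrite N0 expr0n gtn_eqF ?(ltnW t2) // mulr0 mul0r.
    by move=> hh; apply/eqP; rewrite eq_le hh ler0n.
  have h0 : 0 <= h by rewrite /h divr_ge0 ?exprn_ge0.
  have hle : h <= (n0 ^ r)%:R.
    have [N0|N0] := eqVneq (N1 n r s) 0%N.
      by rewrite /h N0 expr0n gtn_eqF ?(ltnW t2) // invr0 mulr0 ler0n.
    rewrite /h ler_pdivrMr ?exprn_gt0 ?ltr0n ?lt0n //.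
    apply: le_trans (homC_le R n sr t2) _; rewrite ler_wpM2r ?exprn_ge0 //.
    rewrite ler_nat; apply: leq_trans (bin_leq_exp _ _) _.
    by rewrite leq_wexp2r // ltnW.
  exists (fun j => if j == 0%N then h - 1 else - eigen_ratio R r s j); split; last first.
    rewrite hE big_nat_cond big1; last first.
      move=> j /andP[/andP[j0 _] _]; rewrite gtn_eqF // subrr expr0n gtn_eqF ?(ltnW t2) //.
      by rewrite mulr0.
    by rewrite eqxx addr0 addrC subrK.
  have CC : (n0 ^ r + 1)%:R <= C / n%:R.
    rewrite ler_pdivlMr // /C; apply: ler_wpDl.
      by rewrite addr_ge0 ?mulr_ge0 ?addr_ge0.
    by rewrite ler_wpM2l // ler_nat ltnW.
  move=> j js; apply: le_trans CC; rewrite natrD; case: eqP => _.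
    have : 0 <= (n0 ^ r)%:R :> R by apply: ler0n.
    by rewrite ler_norml; lra.
  rewrite normrN gtr0_norm ?eigen_ratio_gt0 //.
  by rewrite ler_wpDl // eigen_ratio_le1.
have n4 : (4 * r <= n)%N by apply: leq_trans n0n; rewrite leq_addl.
have rn : (r <= n)%N by rewrite (leq_trans _ n4) // leq_pmull.
have NR0 : 0 < (N1 n r s)%:R :> R by rewrite ltr0n N1_gt0.
pose D i := johnson_mult R n r i.
pose e i := johnson_eigen R n r s i / (N1 n r s)%:R.
have [|||||||delta [dle dE]] := absorb n t D e n1 _ t2.
- have : Q + 2 * K' <= (Num.bound (Q + 2 * K'))%:R.
    by apply/ltW/archi_boundP; rewrite addr_ge0 ?mulr_ge0.
  move=> h; apply: le_trans h _; rewrite ler_nat; apply: leq_trans n0n.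
  by rewrite leq_addr.
- exact: johnson_mult0.
- by rewrite /e johnson_eigen0 divff ?gt_eqF.
- move=> i hi; have := johnson_eigen_asymp R sr n1 n4 (leq_trans hi (ltnW sr)).
  rewrite hi (eqP (_ : i - s == 0)%N) ?subn_eq0 // maxn0 expr1.
  move=> h; apply: le_trans h _; rewrite ler_wpM2r ?invr_ge0 ?ler0n //.
- move=> i /andP[si ir]; have := johnson_eigen_asymp R sr n1 n4 ir.
  rewrite leqNgt si subr0 (maxn_idPr _) ?subn_gt0 //.
  move=> h; apply: le_trans h _; rewrite ler_wpM2r ?invr_ge0 ?exprn_ge0 ?ler0n //.
- move=> i hi; have := johnson_mult_asymp R n1 rn (leq_trans hi (ltnW sr)).
  move=> h; apply: le_trans h _; rewrite ler_wpM2r ?invr_ge0 ?ler0n //.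
- move=> i ir; rewrite johnson_mult_ge0 //= (le_trans (johnson_mult_le R r n i)) //.
  by rewrite -natrX ler_nat bin_leq_exp.
exists delta; split.
  move=> j js; apply: le_trans (dle j js) _; rewrite ler_wpM2r ?invr_ge0 ?ler0n //.
  by rewrite /C lerDl mulr_ge0.
rewrite -dE (homC_spectral R n sr t2) mulr_sumr; apply: eq_bigr => i _.
by rewrite /e expr_div_n mulrCA [X in _ = _ * X]mulrC divfK ?expf_neq0 ?gt_eqF.
Qed.

(** * The dominant term *)

Section DominantTerm.
Variables (R : realType) (r s : nat).
Hypothesis sr : (s < r)%N.
Local Notation rho := (eigen_ratio R r s).
Local Notation a := (a_ R r s).

Lemma expR_a k : (k < s)%N -> expR (a k) = (r - k)%:R / (s - k)%:R.
Proof.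
by move=> ks; rewrite /a_ lnK // posrE divr_gt0 // ltr0n subn_gt0 // (ltn_trans ks).
Qed.

Lemma a_gt0 k : (k < s)%N -> 0 < a k.
Proof.
move=> ks; apply: ln_gt0; rewrite ltr_pdivlMr ?ltr0n ?subn_gt0 // mul1r ltr_nat.
by rewrite ltn_sub2r // (ltn_trans ks).
Qed.

Lemma expR_a_mono k l : (k <= l < s)%N -> expR (a k) <= expR (a l).
Proof.
move=> /andP[kl ls].
have ks : (k < s)%N by apply: leq_ltn_trans ls.
rewrite !expR_a // ler_pdivrMr ?ltr0n ?subn_gt0 // mulrAC ler_pdivlMr ?ltr0n ?subn_gt0 //.
rewrite !natrB ?(ltnW ls) ?(ltnW ks) ?(ltnW (ltn_trans _ sr)) //.
have : k%:R <= l%:R :> R by rewrite ler_nat.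
have : s%:R <= r%:R :> R by rewrite ler_nat ltnW.
nra.
Qed.

Lemma eigen_ratioE k : (k < s)%N -> rho k = rho k.+1 * expR (a k).
Proof.
by move=> ks; rewrite eigen_ratioS // -[(s - k)%:R / _]invf_div -expR_a // divfK // gt_eqF ?expR_gt0.
Qed.

(** The quotient rho_j / rho_i is exp(a_j + ... + a_(i-1)), and a_j is the least of these
    exponents. *)
Lemma eigen_ratio_down j i : (j <= i <= s)%N -> rho i * expR (a j) ^+ (i - j) <= rho j.
Proof.
move=> /andP[ji]; rewrite -(subnKC ji) addKn; elim: (i - j)%N => [|d IH] ds.
  by rewrite addn0 expr0 mulr1.
have js : (j + d < s)%N by rewrite -addnS.
apply: le_trans (IH (ltnW js)); rewrite (eigen_ratioE js) addnS exprS mulrA.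
rewrite ler_wpM2r ?exprn_ge0 ?expR_ge0 //.
rewrite ler_wpM2l ?(ltW (eigen_ratio_gt0 _ _ _)) //.
by rewrite expR_a_mono // leq_addr.
Qed.

(** The mirror image: a_(j-1) is the greatest of the exponents a_i, ..., a_(j-1). *)
Lemma eigen_ratio_up j i : (i <= j <= s)%N -> (0 < j)%N ->
  rho i <= rho j * expR (a j.-1) ^+ (j - i).
Proof.
move=> /andP[ij js] j0; rewrite -{1}(subKn ij); have := leq_subr i j.
elim: (j - i)%N => [|d IH] dj; first by rewrite subn0 expr0 mulr1.
have h : (j - d.+1 < s)%N by lia.
rewrite (eigen_ratioE h) (_ : (j - d.+1).+1 = j - d)%N; last by lia.
rewrite exprSr mulrA; apply: ler_pM.
- by rewrite ltW // eigen_ratio_gt0 //; lia.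
- exact: expR_ge0.
- exact: IH (ltnW dj).
by apply: expR_a_mono; lia.
Qed.

Section FixedSize.
Variables (n t : nat).
Hypothesis n0 : (0 < n)%N.
Let L : R := ln n%:R.
Local Notation w i := (n%:R ^+ i * rho i ^+ t).

Lemma expR_L : expR L = n%:R.
Proof. by rewrite lnK // posrE ltr0n. Qed.

(** The ratio of the weights is at most E^(i-j) with E = n exp(-t a_j) <= 1, hence at most E. So the
    threshold at a_j alone controls all i > j. *)
Lemma weight_down j i : (j < i <= s)%N -> L <= t%:R * a j ->
  w i <= w j * expR (L - t%:R * a j).
Proof.
move=> /andP[ji js] La; set E := expR _.
have j_s : (j < s)%N by apply: leq_trans js.
have EE : E = n%:R / expR (a j) ^+ t.
  by rewrite /E expRB expR_L expRM_natl.
have bt : 0 < expR (a j) ^+ t by rewrite exprn_gt0 ?expR_gt0.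
have h : rho i ^+ t * (expR (a j) ^+ t) ^+ (i - j) <= rho j ^+ t.
  rewrite -exprM mulnC exprM -exprMn.
  apply: lerXn2r; rewrite ?nnegrE.
  - by rewrite mulr_ge0 ?exprn_ge0 ?expR_ge0 ?(ltW (eigen_ratio_gt0 _ _ _)).
  - by rewrite ltW // eigen_ratio_gt0 // ltnW.
  - by apply: eigen_ratio_down; rewrite (ltnW ji).
have E1 : E <= 1 by rewrite /E -[leRHS]expR0 ler_expR subr_le0.
apply: (@le_trans _ _ (w j * E ^+ (i - j))); last first.
  rewrite ler_wpM2l ?mulr_ge0 ?exprn_ge0 ?(ltW (eigen_ratio_gt0 _ _ _)) ?(ltnW j_s) //.
  by rewrite ler_iXnr ?subn_gt0 // ltW // expR_gt0.
rewrite EE [(_ / _) ^+ (_ - _)]expr_div_n -mulrA mulrCA -{1}(subnKC (ltnW ji)) exprD.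
rewrite [leRHS]mulrCA -[leLHS]mulrA ler_wpM2l ?exprn_ge0 //.
by rewrite mulrCA ler_wpM2l ?exprn_ge0 // ler_pdivlMr ?exprn_gt0 ?expR_gt0.
Qed.

Lemma weight_up j i : (i < j <= s)%N -> t%:R * a j.-1 <= L ->
  w i <= w j * expR (t%:R * a j.-1 - L).
Proof.
move=> /andP[ij js] La; set E := expR _.
have j0 : (0 < j)%N by apply: leq_ltn_trans ij.
have j_s : (j.-1 < s)%N by rewrite prednK.
have nR : 0 < n%:R :> R by rewrite ltr0n.
have EE : E = expR (a j.-1) ^+ t / n%:R.
  by rewrite /E expRB expR_L expRM_natl.
have E1 : E <= 1 by rewrite /E -[leRHS]expR0 ler_expR subr_le0.
have h : rho i ^+ t <= rho j ^+ t * (expR (a j.-1) ^+ t) ^+ (j - i).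
  rewrite -exprM mulnC exprM -exprMn.
  apply: lerXn2r; rewrite ?nnegrE.
  - by rewrite ltW // eigen_ratio_gt0 // ltnW // (leq_trans ij).
  - by rewrite mulr_ge0 ?exprn_ge0 ?expR_ge0 ?(ltW (eigen_ratio_gt0 _ _ _)).
  - by apply: eigen_ratio_up => //; rewrite (ltnW ij).
apply: (@le_trans _ _ (w j * E ^+ (j - i))); last first.
  rewrite ler_wpM2l ?mulr_ge0 ?exprn_ge0 ?(ltW (eigen_ratio_gt0 _ _ _)) //.
  by rewrite ler_iXnr ?subn_gt0 // ltW // expR_gt0.
rewrite EE [(_ / _) ^+ (_ - _)]expr_div_n -{1}(subnKC (ltnW ij)) exprD.
rewrite -!mulrA ler_wpM2l ?exprn_ge0 //.
apply: le_trans h _.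
rewrite mulrCA -[leLHS]mulr1 -mulrA ler_wpM2l ?exprn_ge0 ?(ltW (eigen_ratio_gt0 _ _ _)) //.
by rewrite mulrCA mulfV ?expf_neq0 ?gt_eqF // mulr1 lexx.
Qed.

Variables (C : R) (delta : nat -> R).
Hypothesis delta_le : forall j, (j <= s)%N -> `|delta j| <= C / n%:R.
(** As rho_j >= 1/C(r,s), the relative error delta_j / rho_j is at most K/n; [P] bounds (1 +
    K/n)^t. *)
Let K := C * 'C(r, s)%:R.
Let P := expR (K * (t%:R / n%:R)).

Lemma delta_rel j : (j <= s)%N -> `|delta j / rho j| <= K / n%:R.
Proof.
move=> js; have r0 := eigen_ratio_gt0 R sr js.
rewrite normrM normfV (gtr0_norm r0) ler_pdivrMr //.
apply: le_trans (delta_le js) _; rewrite /K -!mulrA.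
have C0 : 0 <= C.
  have := le_trans (normr_ge0 _) (delta_le js).
  by rewrite pmulr_lge0 // invr_gt0 ?ltr0n.
rewrite ler_wpM2l // mulrCA ler_peMr ?invr_ge0 // mulrC.
have c0 : 0 < 'C(r, s)%:R :> R by rewrite ltr0n bin_gt0 ltnW.
by rewrite -ler_pdivrMr // div1r eigen_ratio_ge.
Qed.

Lemma perturbed_factor j : (j <= s)%N -> `|(1 + delta j / rho j) ^+ t - 1| <= P - 1.
Proof.
move=> js; have h := delta_rel js; set x := delta j / rho j in h *.
have pw m : `|(1 + x) ^+ m - 1| <= (1 + `|x|) ^+ m - 1.
  elim: m => [|m IH]; first by rewrite !expr0 subrr normr0.
  rewrite !exprS.
  have -> : (1 + x) * (1 + x) ^+ m - 1 = (1 + x) * ((1 + x) ^+ m - 1) + x by ring.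
  have -> : (1 + `|x|) * (1 + `|x|) ^+ m - 1 =
     (1 + `|x|) * ((1 + `|x|) ^+ m - 1) + `|x| by ring.
  apply: le_trans (ler_normD _ _) _; rewrite lerD2r normrM ler_pM //.
  by apply: le_trans (ler_normD _ _) _; rewrite normr1.
apply: le_trans (pw t) _; rewrite lerD2r /P mulrCA expRM_natl.
apply: lerXn2r; rewrite ?nnegrE ?addr_ge0 ?expR_ge0 //.
by apply: le_trans (expR_ge1Dx _); rewrite lerD2l.
Qed.

Lemma perturbed_term_le j : (j <= s)%N ->
  `|n%:R ^+ j / (j`!)%:R * (rho j + delta j) ^+ t| <= w j * P.
Proof.
move=> js; have r0 := eigen_ratio_gt0 R sr js.
have -> : rho j + delta j = rho j * (1 + delta j / rho j).
  by rewrite mulrDr mulr1 mulrCA divff ?mulr1 ?gt_eqF.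
rewrite exprMn mulrA normrM ler_pM //.
  rewrite ger0_norm ?mulr_ge0 ?divr_ge0 ?exprn_ge0 ?(ltW r0) //.
  rewrite ler_wpM2r ?exprn_ge0 ?(ltW r0) // ler_pdivrMr ?ltr0n ?fact_gt0 //.
  by rewrite ler_peMr ?exprn_ge0 // ler1n fact_gt0.
have := perturbed_factor js; set y := _ ^+ t => h.
rewrite -[y](subrK 1); apply: le_trans (ler_normD _ _) _.
by rewrite normr1 -lerBrDr.
Qed.

Lemma perturbed_term_dist j : (j <= s)%N ->
  `|n%:R ^+ j / (j`!)%:R * (rho j + delta j) ^+ t - n%:R ^+ j / (j`!)%:R * rho j ^+ t|
    <= n%:R ^+ j / (j`!)%:R * rho j ^+ t * (P - 1).
Proof.
move=> js; have r0 := eigen_ratio_gt0 R sr js.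
have -> : rho j + delta j = rho j * (1 + delta j / rho j).
  by rewrite mulrDr mulr1 mulrCA divff ?mulr1 ?gt_eqF.
rewrite exprMn mulrA -[X in _ - X]mulr1 -mulrBr normrM ger0_norm; last first.
  by rewrite mulr_ge0 ?divr_ge0 ?exprn_ge0 ?(ltW r0).
apply: ler_wpM2l; first by rewrite mulr_ge0 ?divr_ge0 ?exprn_ge0 ?(ltW r0).
exact: perturbed_factor.
Qed.

End FixedSize.
End DominantTerm.

(** * Elementary bounds, and sizes of terms for t in a range I_j *)

Lemma expRN_le_inv (R : realType) (y : R) : 0 < y -> expR (- y) <= y^-1.
Proof.
move=> y0; rewrite expRN lef_pV2 ?posrE ?expR_gt0 //.
by apply: le_trans (expR_ge1Dx y); rewrite lerDr.
Qed.

Lemma expR_sub1_le (R : realType) (z : R) : 0 <= z <= 1 / 2 -> expR z - 1 <= 2 * z.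
Proof.
move=> /andP[z0 z1]; have h := expR_ge1Dx (- z); rewrite expRN in h.
have e0 := expR_gt0 z; set e := expR z in h e0 *.
have : e * (1 - z) <= e * e^-1 by rewrite ler_wpM2l // ltW.
rewrite divff ?gt_eqF //.
nra.
Qed.

(** Squares e^(L/2) >= L/2. It makes t/n small in terms of ln n alone. *)
Lemma ln_over_le (R : realType) (x : R) : 1 < x -> ln x / x <= 4 / ln x.
Proof.
move=> x1; have x0 : 0 < x by apply: lt_trans x1.
have L0 := ln_gt0 x1; set L := ln x in L0 *.
rewrite ler_pdivrMr // mulrAC ler_pdivlMr //.
have h : L / 2 <= expR (L / 2) by apply: le_trans (expR_ge1Dx _); rewrite lerDr.
have -> : x = expR (L / 2) ^+ 2.
  by rewrite -expRM_natl mulrCA divff ?mulr1 ?lnK ?posrE // pnatr_eq0.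
have := expR_gt0 (L / 2); nra.
Qed.

Section DominantRange.
Variables (R : realType) (r s : nat).
Hypothesis sr : (s < r)%N.
Local Notation rho := (eigen_ratio R r s).
Local Notation a := (a_ R r s).
Variables (eps eta K alpha : R).
Hypotheses (eps0 : 0 < eps) (eta0 : 0 < eta) (K0 : 0 <= K) (alpha0 : 0 < alpha).
Hypothesis alpha_le : forall k, (k < s)%N -> alpha <= a k.

Variables (n t j : nat).
Hypotheses (n0 : (0 < n)%N) (js : (j <= s)%N).
Local Notation L := (ln (n%:R : R)).
Local Notation w i := (n%:R ^+ i * rho i ^+ t).
Hypothesis L0 : 0 < L.
Hypothesis lo : (j < s)%N -> (1 + eps) * L / a j < t%:R.
Hypothesis hi : (0 < j)%N -> t%:R < (1 - eps) * L / a j.-1.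

Lemma cross_term_le i : (i <= s)%N -> i != j ->
  2 / (eps * eta) <= L -> 2 * K * (1 + eps) / (alpha * eps) <= n%:R ->
  w i * expR (K * (t%:R / n%:R)) <= eta * w j.
Proof.
move=> is_ ij hL hn.
have nR : 0 < n%:R :> R by rewrite ltr0n.
have wj0 : 0 <= w j.
  by rewrite mulr_ge0 ?exprn_ge0 // ltW // eigen_ratio_gt0.
have Kn : K / n%:R * (2 * (1 + eps)) <= alpha * eps.
  have h : 0 < alpha * eps by rewrite mulr_gt0.
  move: hn; rewrite ler_pdivrMr // => hn.
  rewrite mulrAC ler_pdivrMr // mulrA [K * 2]mulrC.
  by rewrite [leRHS]mulrC.
(* The gap in the range of t gives y < -eps L, and the perturbation Kt/n may consume part of it, as
   long as -eps L / 2 remains. *)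
suff [y [h1 h2]] : exists y, w i <= w j * expR y /\ y + K * (t%:R / n%:R) <= - (eps / 2 * L).
  apply: (@le_trans _ _ (w j * expR (- (eps / 2 * L)))).
    apply: (@le_trans _ _ (w j * expR y * expR (K * (t%:R / n%:R)))).
      by rewrite ler_wpM2r ?expR_ge0.
    by rewrite -mulrA -expRD ler_wpM2l // ler_expR.
  rewrite [leRHS]mulrC ler_wpM2l //.
  have e0 : 0 < eps / 2 * L by rewrite mulr_gt0 // divr_gt0.
  apply: le_trans (expRN_le_inv e0) _.
  rewrite -[eta]invrK lef_pV2 ?posrE ?invr_gt0 //.
  move: hL; rewrite ler_pdivrMr ?mulr_gt0 // => hL.
  rewrite -[leLHS]mul1r ler_pdivrMr //.
  lra.
have tn : K * (t%:R / n%:R) = K / n%:R * t%:R by rewrite mulrA mulrAC.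
have t0 : 0 <= t%:R :> R by [].
have epsL : 0 < eps * L by rewrite mulr_gt0.
have [lo' hi'] := (lo, hi).
set T := t%:R : R in lo' hi' tn t0 *.
set k := K / n%:R in Kn tn *.
case: (ltngtP i j) ij => // ij _.
- have j0 : (0 < j)%N by apply: leq_ltn_trans ij.
  have j_s : (j.-1 < s)%N by rewrite prednK.
  have a0 := a_gt0 R sr j_s.
  have := hi' j0; rewrite ltr_pdivlMr // => h.
  have aj := alpha_le j_s.
  exists (T * a j.-1 - L); split.
    by apply: weight_up => //; [rewrite ij | lra].
  rewrite tn.
  have k1 : k <= alpha * eps / 2.
    have : 0 <= k * eps by rewrite mulr_ge0 ?(ltW eps0) // /k divr_ge0 // ltW.
    lra.
  have k2 : k * T <= eps / 2 * (T * a j.-1).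
    have : k * T <= alpha * eps / 2 * T by rewrite ler_wpM2r.
    have : alpha * (eps / 2 * T) <= a j.-1 * (eps / 2 * T).
      by rewrite ler_wpM2r // mulr_ge0 // divr_ge0 // ltW.
    lra.
  have : eps / 2 * (T * a j.-1) <= eps / 2 * L.
    by rewrite ler_wpM2l ?divr_ge0 // ?(ltW eps0) //; lra.
  lra.
have j_s : (j < s)%N by apply: leq_trans is_.
have a0 := a_gt0 R sr j_s.
have := lo' j_s; rewrite ltr_pdivrMr // => h.
have aj := alpha_le j_s.
exists (L - T * a j); split.
  by apply: weight_down => //; [rewrite ij | lra].
rewrite tn.
(* For j = 0 there is no upper bound on t, so the perturbation is charged to T a_j instead of L. The
   share g satisfies (1 - g)(1 + eps) = 1 + eps/2. *)
pose g := eps / (2 * (1 + eps)).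
have d0 : 0 < 2 * (1 + eps) by rewrite mulr_gt0 // addr_gt0.
have gE : g * (2 * (1 + eps)) = eps by rewrite /g divfK // gt_eqF.
have g0 : 0 < g by rewrite /g divr_gt0.
have g1 : g < 1 by rewrite /g ltr_pdivrMr // mul1r; have := eps0; lra.
have k1 : k <= alpha * g.
  have : k * (2 * (1 + eps)) <= alpha * g * (2 * (1 + eps)) by rewrite -mulrA gE.
  by rewrite ler_pM2r.
have k2 : k * T <= g * (T * a j).
  have : k * T <= alpha * g * T by rewrite ler_wpM2r.
  have : alpha * (g * T) <= a j * (g * T) by rewrite ler_wpM2r // mulr_ge0 // ltW.
  lra.
have : (1 + eps) * L * (1 - g) <= T * a j * (1 - g) by rewrite ler_wpM2r ?subr_ge0 ?(ltW g1) // ltW.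
have : L * (g * (2 * (1 + eps))) = L * eps by rewrite gE.
lra.
Qed.

(** For j > 0 the range gives t <= L/alpha, whence Kt/n <= 4K/(alpha L). For j = 0 no such bound
    holds, but there the error is not raised to a power. *)
Lemma perturbation_small : (0 < j)%N ->
  8 * K / alpha <= L -> 8 * K / (alpha * eta) <= L ->
  expR (K * (t%:R / n%:R)) - 1 <= eta.
Proof.
move=> j0 h1 h2.
have nR : 0 < n%:R :> R by rewrite ltr0n.
have n1 : 1 < n%:R :> R.
  by rewrite ltNge; apply/negP => /ln_le0; rewrite leNgt L0.
have j_s : (j.-1 < s)%N by rewrite prednK.
have a0 := a_gt0 R sr j_s.
have := hi j0; rewrite ltr_pdivlMr // => h.
have aj := alpha_le j_s.
have ta : t%:R * alpha <= L.
  have : t%:R * alpha <= t%:R * a j.-1 by rewrite ler_wpM2l.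
  have : 0 < eps * L by rewrite mulr_gt0.
  lra.
set z := K * _.
have z0 : 0 <= z by rewrite /z mulr_ge0 // divr_ge0 // ltW.
have zL : z * (alpha * L) <= 4 * K.
  have -> : z * (alpha * L) = K * (t%:R * alpha * L / n%:R) by rewrite /z; ring.
  rewrite [leRHS]mulrC ler_wpM2l //.
  have := ln_over_le n1; rewrite ler_pdivlMr // => hh.
  apply: le_trans hh; rewrite mulrAC ler_wpM2r ?(ltW L0) //.
  by rewrite ler_wpM2r // invr_ge0 ltW.
have aL : 0 < alpha * L by rewrite mulr_gt0.
move: h1 h2; rewrite !ler_pdivrMr ?mulr_gt0 // => h1 h2.
have z1 : z <= 1 / 2 by rewrite -(ler_pM2r aL); lra.
have z2 : z <= eta / 2 by rewrite -(ler_pM2r aL); lra.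
apply: le_trans (expR_sub1_le _) _; last by lra.
by rewrite z0.
Qed.

End DominantRange.

Lemma hom_cycle_dominant_term (R : realType) (r s : nat) (eps : R) (j : nat)
    (tn : nat -> nat) : (s < r)%N -> (1 <= s)%N -> 0 < eps -> (j <= s)%N ->
  (exists n0 : nat, forall n, (n0 <= n)%N -> inI r s eps j n (tn n)) ->
  forall eta : R, 0 < eta -> exists n1 : nat, forall n, (n1 <= n)%N ->
    `|(homC (tn n) n r s)%:R - (N1 n r s)%:R ^+ tn n * (n%:R ^+ j / (j`!)%:R) *
                 eigen_ratio R r s j ^+ tn n|
    <= eta * `|(N1 n r s)%:R ^+ tn n * (n%:R ^+ j / (j`!)%:R) *
                 eigen_ratio R r s j ^+ tn n|.
Proof.
move=> sr s1 eps0 js [m0 tnI] eta eta0.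
have [C C0 expansion] := hom_cycle_expansion R sr.
pose K := C * 'C(r, s)%:R.
have K0 : 0 <= K by rewrite mulr_ge0 // ltW.
pose alpha := a_ R r s 0.
have alpha0 : 0 < alpha by apply: a_gt0.
have alpha_le k : (k < s)%N -> alpha <= a_ R r s k.
  by move=> ks; rewrite -ler_expR expR_a_mono.
(* One share of [eta'] for the term j and 2 j! shares for each other term: j! turns the weight [w j]
   into the main term, and 2 covers |1 + delta_0| <= 2. *)
pose M : R := 1 + (s.+1)%:R * (2 * (j`!)%:R).
have M0 : 0 < M by rewrite ltr_wpDr ?mulr_ge0.
pose eta' := eta / M.
have eta'0 : 0 < eta' by rewrite divr_gt0.
(* All the lower bounds that ln n must exceed; the sum of their absolute values dominates each of
   them. *)
pose B := [:: 2 / (eps * eta'); 2 * K * (1 + eps) / (alpha * eps); 8 * K / alpha;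
  8 * K / (alpha * eta'); C; C / eta'; 2 * `|a_ R r s j|; 1].
have [b [b1 b2 b3 b4 [b5 b6 b7 b8]]] : exists b : R,
    [/\ 2 / (eps * eta') <= b, 2 * K * (1 + eps) / (alpha * eps) <= b,
     8 * K / alpha <= b, 8 * K / (alpha * eta') <= b &
     [/\ C <= b, C / eta' <= b, 2 * `|a_ R r s j| <= b & 1 <= b]].
  exists (\sum_(x <- B) `|x|).
  have mem x : x \in B -> x <= \sum_(x <- B) `|x|.
    move=> xB; rewrite (big_rem x) //=; apply: (le_trans (ler_norm x)).
    by rewrite lerDl sumr_ge0.
  by split; [..|split]; apply: mem; rewrite !inE eqxx ?orbT.
exists (maxn m0 (Num.bound (expR b)).+1) => n; rewrite geq_max => /andP[m0n bn].
have {tnI} := tnI n m0n; set t := tn n => tI.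
have n0 : (0 < n)%N by apply: leq_trans bn.
have nR : 0 < n%:R :> R by rewrite ltr0n.
have bL : b <= ln (n%:R : R).
  rewrite -(expRK b) ler_ln ?posrE ?expR_gt0 //.
  apply: le_trans (ltW (archi_boundP (expR_ge0 b))) _.
  by rewrite ler_nat ltnW.
set L := ln _ in bL.
have L0 : 0 < L by apply: lt_le_trans bL; apply: lt_le_trans b8.
have Ln : L <= n%:R by rewrite ltW // ln_sublinear.
have lo : (j < s)%N -> (1 + eps) * L / a_ R r s j < t%:R.
  move=> jls; move: tI; rewrite /inI (ltn_eqF jls).
  by case: eqP => [->|_] // /andP[].
have hi : (0 < j)%N -> t%:R < (1 - eps) * L / a_ R r s j.-1.
  move=> j0; move: tI; rewrite /inI (gtn_eqF j0).
  by case: eqP => [->|_] /andP[].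
(* Only [I_s] contains this bound by definition; for j < s it follows from ln n >= 2 a_j. *)
have t2 : (2 <= t)%N.
  have [jls|sj] := ltnP j s; last first.
    move: tI; have -> : j = s by apply/eqP; rewrite eqn_leq js.
    by rewrite /inI eqxx gtn_eqF // => /andP[].
  have aj := a_gt0 R sr jls.
  have : 2 < t%:R :> R; last by rewrite ltr_nat => /ltnW.
  apply: lt_trans (lo jls); rewrite ltr_pdivlMr //.
  have epsL : 0 < eps * L by rewrite mulr_gt0.
  move: b7; rewrite gtr0_norm // => b7; lra.
have [delta [delta_le hE]] := expansion n t n0 t2.
rewrite hE -[_ ^+ t * _ * _]mulrA -mulrBr [in leLHS]normrM [in leRHS]normrM.
rewrite [leRHS]mulrCA; apply: ler_wpM2l => //.
set P := expR (K * (t%:R / n%:R)).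
pose term i := if i == 0%N then 1 + delta 0 else
  n%:R ^+ i / (i`!)%:R * (eigen_ratio R r s i + delta i) ^+ t.
have -> : 1 + delta 0 + \sum_(1 <= i < s.+1) n%:R ^+ i / (i`!)%:R *
    (eigen_ratio R r s i + delta i) ^+ t = \sum_(i < s.+1) term i.
  rewrite -(big_mkord xpredT term) big_ltn //; congr (_ + _).
  apply: eq_big_nat => i /andP[i0 _].
  by rewrite /term gtn_eqF.
pose w i : R := n%:R ^+ i * eigen_ratio R r s i ^+ t.
set T := n%:R ^+ j / (j`!)%:R * eigen_ratio R r s j ^+ t.
have T0 : 0 <= T.
  by rewrite mulr_ge0 ?divr_ge0 ?exprn_ge0 // ltW // eigen_ratio_gt0.
have wT : w j = (j`!)%:R * T.
  by rewrite /w /T mulrA mulrCA divff ?mulr1 // pnatr_eq0 -lt0n fact_gt0.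
have C_n : C / n%:R <= 1 by rewrite ler_pdivrMr // mul1r (le_trans b5) // (le_trans bL).
have C_eta : C / n%:R <= eta'.
  by rewrite ler_pdivrMr // mulrC -ler_pdivrMr // (le_trans b6) // (le_trans bL).
have P1 : 1 <= P.
  by apply: le_trans (expR_ge1Dx _); rewrite lerDl mulr_ge0 // divr_ge0.
have self : `|term j - T| <= eta' * T.
  rewrite /term /T; case: eqP => [->|/eqP j0].
    rewrite expr0 fact0 divr1 mul1r eigen_ratio0 // expr1n mulr1 addrC addKr.
    by apply: le_trans (delta_le _ _) _.
  rewrite -lt0n in j0.
  apply: le_trans (perturbed_term_dist sr t n0 delta_le js) _.
  rewrite mulrC ler_wpM2r //.
  rewrite -/K; apply: (perturbation_small sr eps0 eta'0 K0 alpha0 alpha_le n0 js L0 hi j0).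
    exact: le_trans bL.
  exact: le_trans bL.
have cross i : (i <= s)%N -> i != j -> `|term i| <= 2 * (j`!)%:R * (eta' * T).
  move=> is_ ij; apply: (@le_trans _ _ (2 * (w i * P))).
    rewrite /term; case: eqP => [->|_].
      rewrite /w expr0 eigen_ratio0 // expr1n !mul1r.
      apply: le_trans (ler_normD _ _) _; rewrite normr1.
      have := le_trans (delta_le 0 isT) C_n; lra.
    apply: le_trans (perturbed_term_le sr t n0 delta_le is_) _.
    rewrite -/P -/(w i) mulr_natl mulr2n lerDl mulr_ge0 ?expR_ge0 //.
    by rewrite /w mulr_ge0 ?exprn_ge0 // ltW // eigen_ratio_gt0.
  rewrite -mulrA ler_wpM2l // [leRHS]mulrCA -wT.
  apply: (cross_term_le sr eps0 eta'0 K0 alpha0 alpha_le n0 js L0 lo hi is_ ij).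
    exact: le_trans bL.
  by apply: le_trans Ln; apply: le_trans bL.
have jo : (j < s.+1)%N by rewrite ltnS.
rewrite (bigD1 (Ordinal jo)) //= addrAC.
apply: le_trans (ler_normD _ _) _; rewrite (ger0_norm T0).
have -> : eta * T = eta' * T + (s.+1)%:R * (2 * (j`!)%:R * (eta' * T)).
  rewrite {1}(_ : eta = eta' * M); last by rewrite divfK ?gt_eqF.
  by rewrite /M; ring.
apply: lerD => //; apply: le_trans (ler_norm_sum _ _ _) _.
rewrite mulr_natl -[X in _ *+ X]card_ord -sumr_const big_mkcond /=.
apply: ler_sum => i _; case: ifP => ij; first by apply: cross => //; rewrite -ltnS.
by apply: mulr_ge0 => //; apply: mulr_ge0 => //; apply: ltW.
Qed.

Local Open Scope classical_set_scope.
Local Open Scope ring_scope.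

Theorem theorem3 (R : realType) (r s : nat) (hsr : (s < r)%N) :
  (exists C : R, forall n t : nat, (1 <= n)%N -> (2 <= t)%N ->
     exists delta : nat -> R,
       (forall j, (j <= s)%N -> `|delta j| <= C / n%:R) /\
       (homC t n r s)%:R =
         (N1 n r s)%:R ^+ t *
         (1 + delta 0%N +
          \sum_(1 <= j < s.+1)
             (n%:R ^+ j / (j`!)%:R) *
             ('C(r - j, s - j)%:R / 'C(r, s)%:R + delta j) ^+ t))
  /\
  ((1 <= s)%N -> forall eps : R, 0 < eps ->
     forall (j : nat) (tn : nat -> nat), (j <= s)%N ->
       (exists n0 : nat, forall n, (n0 <= n)%N -> inI r s eps j n (tn n)) ->
       (fun n : nat => (homC (tn n) n r s)%:R : R^o)
         ~_\oo
       (fun n : nat => ((N1 n r s)%:R ^+ tn n * (n%:R ^+ j / (j`!)%:R) *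
                 ('C(r - j, s - j)%:R / 'C(r, s)%:R) ^+ tn n : R^o))).
Proof.
split; first by have [C _ H] := hom_cycle_expansion R hsr; exists C.
move=> s1 eps eps0 j tn js tnI; apply/eqaddoP => eta eta0.
have [n1 H] := hom_cycle_dominant_term hsr s1 eps0 js tnI eta0.
by apply: filterS (nbhs_infty_ge n1) => n; exact: H.
Qed.
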